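(* Fix $n\ge1$. For each $f\in W_{Dir}$ there exists a unique $u\in W_{Dir}$ satisfying $$ \begin{aligned} f(x) ={}& \chi_{A_n}(x)\int_{A_n} J(x,y)(u(y)-u(x))\,dy + \chi_{A_n}(x)\int_{B_n} R(x,y)(u(y)-u(x))\,dy\\ &+\chi_{B_n}(x)\int_{A_n} R(x,y)(u(y)-u(x))\,dy+\chi_{B_n}(x)\int_{B_n} G(x,y)(u(y)-u(x))\,dy,\qquad x\in\Omega, \end{aligned} $$ and this $u$ is the minimizer over $W_{Dir}$ of the functional $$ \begin{aligned} E_n(v)={}&\frac14\int_{A_n}\int_{A_n}J(x,y)(v(y)-v(x))^2\,dy\,dx+\frac14\int_{B_n}\int_{B_n}G(x,y)(v(y)-v(x))^2\,dy\,dx\\ &+\frac12\int_{A_n}\int_{B_n}R(x,y)(v(y)-v(x))^2\,dy\,dx+\int_\Omega f(x)v(x)\,dx . \end{aligned} $$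
   Context: $\Omega\subset\mathbb{R}^N$ is a bounded domain (open, connected). The kernels $V=J,G,R$ each satisfy: $V:\mathbb{R}^N\times\mathbb{R}^N\to\mathbb{R}$ is continuous and non-negative, $V(x,x)>0$ for every $x$, $V(x,y)=V(y,x)$ for all $x,y$, and $\int_{\mathbb{R}^N}V(x,y)\,dy=1$ for every $x$. $A_n,B_n$ are measurable sets with $\mathbb{R}^N=A_n\cup B_n$ and $A_n\cap B_n=\emptyset$; $\chi_E$ denotes the characteristic function of $E$. $W_{Dir}=\{u\in L^2(\mathbb{R}^N): u=0\text{ in }\mathbb{R}^N\setminus\Omega\}$. The equation is understood for a.e. $x\in\Omega$. *)

(* Defs.v *)
From HB Require Import structures.
From mathcomp Require Import all_boot all_order all_algebra.
From mathcomp Require Import all_classical all_reals all_analysis.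
Set Implicit Arguments.
Unset Strict Implicit.
Unset Printing Implicit Defensive.
Import Order.TTheory GRing.Theory Num.Theory.
Import numFieldNormedType.Exports.
Local Open Scope classical_set_scope.
Local Open Scope ring_scope.

(* The library has no Lebesgue measure on R^N: it is built here as the
   Caratheodory measure of the box-covering outer measure. The dimension is
   N.+1, i.e. any positive integer. *)

Definition box (R : realType) (N : nat) (c : 'rV[R]_N.+1 * 'rV[R]_N.+1) :
    set 'rV[R]_N.+1 :=
  [set x | forall i, c.1 ord0 i < x ord0 i <= c.2 ord0 i].

(* Since there is at least one factor, this is 0 when the box is empty. *)
Definition box_volume (R : realType) (N : nat)
    (c : 'rV[R]_N.+1 * 'rV[R]_N.+1) : R :=
  \prod_(i < N.+1) Num.max 0 (c.2 ord0 i - c.1 ord0 i).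

Definition lebesgue_outer (R : realType) (N : nat) (X : set 'rV[R]_N.+1) :
    \bar R :=
  ereal_inf [set (\sum_(0 <= k <oo) (box_volume (c k))%:E)%E |
    c in [set c : nat -> 'rV[R]_N.+1 * 'rV[R]_N.+1 |
          X `<=` \bigcup_k box (c k)]].

Section lebesgue_outer_lemmas.
Local Open Scope ereal_scope.
Context (R : realType) (N : nat).
Notation leb := (@lebesgue_outer R N).
Notation vol := (fun c => (@box_volume R N c)%:E).

Lemma box_volume_ge0 c : (0 <= @box_volume R N c)%R.
Proof. by apply: prodr_ge0 => i _; rewrite le_max lexx. Qed.

Lemma lebesgue_outer_ge0 X : 0 <= leb X.
Proof.
apply: le_ereal_inf_tmp => _ [c _ <-].
by apply: nneseries_ge0 => k _ _; rewrite lee_fin box_volume_ge0.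
Qed.

Lemma lebesgue_outer0 : leb set0 = 0.
Proof.
apply/eqP; rewrite eq_le lebesgue_outer_ge0 andbT.
apply: ereal_inf_lbound; exists (fun=> (0, 0)%R); first by [].
apply: eseries0 => k _ _ /=.
by rewrite /box_volume big_ord_recl !mxE subrr maxxx mul0r.
Qed.

Lemma le_lebesgue_outer : {homo leb : X Y / X `<=` Y >-> X <= Y}.
Proof.
move=> X Y XY; apply/ereal_inf_le_tmp => _ [c Yc <-].
by exists c => //; exact: subset_trans XY Yc.
Qed.

Lemma lebesgue_outer_sigma_subadditive : sigma_subadditive leb.
Proof.
move=> A; have [[i ioo]|] := pselect (exists i, leb (A i) = +oo).
  by rewrite (eseries_pinfty _ _ ioo) ?leey// => n _;
    rewrite -ltNye (lt_le_trans _ (lebesgue_outer_ge0 _)).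
rewrite -forallNE => Aoo.
suff add2e (e : {posnum R}) :
    leb (\bigcup_n A n) <= \sum_(i <oo) leb (A i) + e%:num%:E.
  by apply/lee_addgt0Pr => _/posnumP[].
rewrite (le_trans _ (epsilon_trick _ _ _))//; last first.
  by move=> n; exact: lebesgue_outer_ge0.
pose P n (c : nat -> 'rV[R]_N.+1 * 'rV[R]_N.+1) :=
  A n `<=` \bigcup_k box (c k) /\
  \sum_(k <oo) vol (c k) <= leb (A n) + (e%:num / (2 ^ n.+1)%:R)%:E.
have [g Pg] : {g & forall n, P n (g n)}.
  apply: (@choice _ _ P) => n; rewrite /P /lebesgue_outer.
  set S := (X in ereal_inf X); move infS : (ereal_inf S) => iS.
  case: iS infS => [r Sr|Soo|Soo].
  - have en1 : (0 < e%:num / (2 ^ n.+1)%:R)%R by [].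
    have /(lb_ereal_inf_adherent en1) : ereal_inf S \is a fin_num by rewrite Sr.
    by move=> [x [c Ac <-] xS]; exists c; split => //; rewrite -Sr; exact/ltW.
  - by have := Aoo n; rewrite /lebesgue_outer -/S Soo.
  - suff : lbound S 0 by move/le_ereal_inf_tmp; rewrite Soo.
    move=> /= _ [c _ <-]; apply: nneseries_ge0 => k _ _.
    by rewrite lee_fin box_volume_ge0.
have vol_ge0 x : 0 <= (vol \o uncurry g) x by rewrite lee_fin box_volume_ge0.
apply: (@le_trans _ _ (\esum_(i in setT) (vol \o uncurry g) i)).
  apply: ereal_inf_lbound => /=.
  have /card_esym/ppcard_eqP[h] := card_nat2.
  exists (uncurry g \o h).
    move=> t [i _ /(proj1 (Pg i))[j _ gijt]].
    by exists (h^-1%FUN (i, j)) => //=; rewrite invK ?inE.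
  rewrite -(esum_pred_image (vol \o uncurry g) _ xpredT) ?[fun=> _]set_true//.
  by rewrite image_eq.
rewrite (_ : esum _ _ = \sum_(i <oo) \sum_(j <oo) vol (g i j)); last first.
  pose I : nat -> set (nat * nat) := fun i => [set (i, j) | j in setT].
  rewrite (_ : setT = \bigcup_k I k); last first.
    by rewrite predeqE => -[a b]; split => // _; exists a => //; exists b.
  rewrite esum_bigcupT /=; last 2 first.
    - apply/trivIsetP => i j _ _ ij.
      rewrite predeqE => -[n m] /=; split => //= -[] [_] _ [<-{n} _].
      by move=> [m' _] [] /esym/eqP; rewrite (negbTE ij).
    - by move=> x; exact: vol_ge0.
  rewrite -(image_id [set: nat]) -fun_true esum_pred_image//; last first.
    by move=> n _; apply: esum_ge0 => x _; exact: vol_ge0.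
  apply: eq_eseriesr => /= j _.
  rewrite -(esum_pred_image (vol \o uncurry g) (pair j) predT)//=; last 2 first.
    - by move=> k _; exact: (vol_ge0 (j, k)).
    - by move=> ? ? _ _; exact: (@can_inj _ _ _ snd).
  by congr esum; rewrite predeqE => -[a b]; split; move=> [i _ <-]; exists i.
apply: lee_lim.
- apply: is_cvg_nneseries => n _ _.
  by apply: nneseries_ge0 => m _ _; exact: (vol_ge0 (n, m)).
- by apply: is_cvg_nneseries => n _ _; apply: adde_ge0 => //;
    exact: lebesgue_outer_ge0.
- by near=> n; apply: lee_sum => i _; exact: (proj2 (Pg i)).
Unshelve. all: by end_near. Qed.

End lebesgue_outer_lemmas.

HB.instance Definition _ (R : realType) (N : nat) :=
  isOuterMeasure.Build R 'rV[R]_N.+1 (@lebesgue_outer R N)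
    (@lebesgue_outer0 R N) (@lebesgue_outer_ge0 R N) (@le_lebesgue_outer R N)
    (@lebesgue_outer_sigma_subadditive R N).

(* The carrier is 'rV[R]_N.+1 itself; `measurable` on it is Lebesgue
   (Caratheodory) measurability, not just Borel measurability. *)
Notation lebT R N := (caratheodory_type (@lebesgue_outer R N)).

Definition leb (R : realType) (N : nat) : set (lebT R N) -> \bar R :=
  @lebesgue_outer R N.

Arguments leb R N : clear implicits.

HB.instance Definition _ (R : realType) (N : nat) := isMeasure.Build _ _ _
  (leb R N) (@lebesgue_outer0 R N) (@lebesgue_outer_ge0 R N)
  (@caratheodory_measure_sigma_additive R _ (@lebesgue_outer R N)).

Section nonlocal.
Context (R : realType) (N : nat).
Notation E := 'rV[R]_N.+1.
Notation mu := (leb R N).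
Implicit Types (Omega A B : set E) (V J G K : E -> E -> R) (f u v w : E -> R).

Definition nonlocal_kernel V : Prop :=
  [/\ continuous (fun p : E * E => V p.1 p.2),
      forall x y, 0 <= V x y,
      forall x, 0 < V x x,
      forall x y, V x y = V y x &
      forall x, (\int[mu]_y (V x y)%:E = 1)%E].

(* Elements of L^2 are represented by functions; all statements about them are
   up to almost everywhere equality. *)
Definition W_Dir Omega u : Prop :=
  (u : lebT R N -> R) \in Lfun mu 2%:E /\
  (\forall x \ae mu, ~ Omega x -> u x = 0).

(* The kernels J, G, K act inside A, inside B and across A and B respectively.
   Integrals are kept in \bar R, without projecting infinite values to 0. *)
Definition nonlocal_op J G K A B u (x : E) : \bar R :=
  ((\1_A x)%:E * \int[mu]_(y in A) (J x y * (u y - u x))%:E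
   + (\1_A x)%:E * \int[mu]_(y in B) (K x y * (u y - u x))%:E
   + (\1_B x)%:E * \int[mu]_(y in A) (K x y * (u y - u x))%:E
   + (\1_B x)%:E * \int[mu]_(y in B) (G x y * (u y - u x))%:E)%E.

Definition solves Omega J G K A B f u : Prop :=
  \forall x \ae mu, Omega x -> (f x)%:E = nonlocal_op J G K A B u x.

Definition energy Omega J G K A B f v : \bar R :=
  ((4^-1)%:E *
     \int[mu]_(x in A) \int[mu]_(y in A) (J x y * (v y - v x) ^+ 2)%:E
   + (4^-1)%:E *
     \int[mu]_(x in B) \int[mu]_(y in B) (G x y * (v y - v x) ^+ 2)%:E
   + (2^-1)%:E *
     \int[mu]_(x in A) \int[mu]_(y in B) (K x y * (v y - v x) ^+ 2)%:E
   + \int[mu]_(x in Omega) (f x * v x)%:E)%E.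

Definition minimizer (W : (E -> R) -> Prop) (F : (E -> R) -> \bar R) u : Prop :=
  W u /\ forall v, W v -> (F u <= F v)%E.

End nonlocal.

(* Main.v *)
Require Import Defs.
From HB Require Import structures.
From mathcomp Require Import all_boot all_order all_algebra.
From mathcomp Require Import all_classical all_reals all_analysis.
From mathcomp Require Import measurable_realfun.
From mathcomp Require Import ring lra.
Set Implicit Arguments.
Unset Strict Implicit.
Unset Printing Implicit Defensive.
Import Order.TTheory GRing.Theory Num.Theory.
Import numFieldNormedType.Exports.
Local Open Scope classical_set_scope.
Local Open Scope ring_scope.

(** The four integrals of the equation are one integral against the symmetric
    kernel [two_phase], which is [J] on A x A, [G] on B x B and [K] across, so
    the equation is [f = L u] on Omega with [L u x = \int k(x,y)(u y - u x) dy].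
    With [dform u v = \int\int k(x,y)(u y - u x)(v y - v x)], symmetry of [k]
    gives Green's formula [dform u v = - 2 \int v (L u)] ([dformE]), and the
    energy is [dform v v / 4 + \int f v].  Expanding it around a solution [u],
    Green's formula cancels the linear part and leaves
    [energy v = energy u + dform (v - u) (v - u) / 4] ([potential_solution]).
    Everything then rests on the Poincare inequality
    [\int v^2 <= C (dform v v)] for [v] vanishing outside Omega: it makes the
    last term vanish only for [v = u], hence solutions are minimizers,
    minimizers equal any solution, and both are unique.

    Poincare inequality.  Say that a set is controlled when [\int v^2] over it
    is at most a constant times [dform v v].  If [k >= c > 0] on U x Q and Q has
    positive measure, control passes from Q to U by averaging
    [v(x)^2 <= 2 (v y - v x)^2 + 2 v(y)^2] over y in Q ([controlled_transfer]).
    As [k] is bounded below near each diagonal point, the set of points having a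
    controlled ball is open and closed; it contains the points far from Omega,
    where [v] vanishes, so it is the whole space ([controlled_ball]), and
    compactness gives [poincare].

    Existence.  For a nonnegative datum [f], the damped Jacobi iteration [relax]
    started at 0 and run with the truncated data [min f n] is nondecreasing,
    because [k >= 0].  Monotonicity makes each iterate a subsolution
    [- L u <= f]; testing with the iterate itself and using the Poincare
    inequality bounds the iterates in L^2 ([subsolution_bound]), so monotone
    convergence yields an L^2 limit and passes to the limit in the equation
    ([solution_nonneg]).  Signed data split into positive and negative parts.

    The Lebesgue measure of R^N enters through four facts, proved from its
    definition as an outer measure: half-spaces are Caratheodory measurable,
    it is sigma-finite, continuous functions on pairs of points are measurable
    for the product sigma-algebra, and, by translation invariance, nonempty
    open sets have positive measure. *)

(** * Square-integrable functions *)

Section square_integrable.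
Context d (T : measurableType d) (R : realType).
Variable mu : {measure set T -> \bar R}.

Lemma Lfun2P (u : T -> R) : u \in Lfun mu 2%:E <->
  measurable_fun setT u /\ mu.-integrable setT (EFin \o (fun x => u x ^+ 2)).
Proof.
split=> [u2|[mu_ iu]].
  split; last exact: Lfun2_integrable_sqr.
  by move: u2; rewrite inE => /andP[]; rewrite inE.
rewrite inE; apply/andP; split; rewrite inE//=.
rewrite /finite_norm unlock; apply: poweR_lty.
under eq_integral do rewrite /= powR_mulrn// -normrX.
by case/integrableP : iu.
Qed.

Lemma Lfun2_measurable (u : T -> R) :
  u \in Lfun mu 2%:E -> measurable_fun setT u.
Proof. by case/Lfun2P. Qed.

Lemma Lfun2_mul_integrable (u v : T -> R) :
  u \in Lfun mu 2%:E -> v \in Lfun mu 2%:E ->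
  mu.-integrable setT (EFin \o (fun x => u x * v x)).
Proof. by move=> u2 v2; apply/Lfun1_integrable; exact: Lfun2_mul_Lfun1. Qed.

Lemma Lfun2B (u v : T -> R) :
  u \in Lfun mu 2%:E -> v \in Lfun mu 2%:E ->
  (fun x => u x - v x) \in Lfun mu 2%:E.
Proof.
move=> u2 v2; have p1 : (1 <= 2%:E :> \bar R)%E by rewrite lee_fin ler1n.
have := Lfun_addr_closed mu p1 => -[_ D].
have := D u (\- v) u2; apply.
exact: Lfun_oppr_closed.
Qed.

Lemma le_Lfun2 (u v : T -> R) : measurable_fun setT u ->
  (forall x, `|u x| <= `|v x|) -> v \in Lfun mu 2%:E -> u \in Lfun mu 2%:E.
Proof.
move=> mu_ uv /Lfun2P[mv iv]; apply/Lfun2P; split => //.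
apply: le_integrable iv => //.
  by apply/measurable_EFinP; exact: measurable_funX.
move=> x _; rewrite /= lee_fin !normrX lerXn2r ?nnegrE//.
Qed.

Lemma Lfun2_measurable_sqr (D : set T) (v : T -> R) : v \in Lfun mu 2%:E ->
  measurable_fun D (fun x => (v x ^+ 2)%:E).
Proof.
move=> v2; apply/measurable_EFinP; apply: measurable_funX.
exact: measurable_funTS (Lfun2_measurable v2).
Qed.

End square_integrable.

(** Monotone convergence in L^2.  The limit is defined everywhere as the real
    part of the extended limit, which is measurable; the squares converge to an
    integrable function, so the extended limit is infinite only on a null set. *)
Lemma Lfun2_monotone_limit d (T : measurableType d) (R : realType)
    (mu : {measure set T -> \bar R}) (u_ : nat -> T -> R) (b : R) :
  (forall n, measurable_fun setT (u_ n)) -> (forall n x, 0 <= u_ n x) ->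
  (forall x, {homo u_ ^~ x : n m / (n <= m)%N >-> n <= m}) ->
  (forall n, (\int[mu]_x (u_ n x ^+ 2)%:E <= b%:E)%E) ->
  exists u, [/\ u \in Lfun mu 2%:E, (forall x, 0 <= u x) &
    {ae mu, forall x, u_ n x @[n --> \oo] --> u x}].
Proof.
move=> mu_ u0 nd ub.
pose U x := limn (EFin \o u_ ^~ x); pose u x := fine (U x).
pose h x := limn (fun n => (u_ n x ^+ 2)%:E).
have ndU x : {homo EFin \o u_ ^~ x : n m / (n <= m)%N >-> (n <= m)%E}.
  by move=> n m nm /=; rewrite lee_fin nd.
have ndh x : {homo (fun n => (u_ n x ^+ 2)%:E) : n m / (n <= m)%N >-> (n <= m)%E}.
  by move=> n m nm; rewrite lee_fin lerXn2r ?nnegrE// nd.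
have mU : measurable_fun setT U.
  apply: (@emeasurable_fun_cvg _ _ _ _ (fun n x => (u_ n x)%:E)) => [n|x _].
    exact/measurable_EFinP.
  exact: (ereal_nondecreasing_is_cvgn (ndU x)).
have mh : measurable_fun setT h.
  apply: (@emeasurable_fun_cvg _ _ _ _ (fun n x => (u_ n x ^+ 2)%:E)) => [n|x _].
    by apply/measurable_EFinP; exact: measurable_funX.
  exact: (ereal_nondecreasing_is_cvgn (ndh x)).
have mu' : measurable_fun setT u.
  exact: (measurableT_comp (@fine_measurable R setT measurableT) mU).
have U0 x : (0 <= U x)%E.
  apply: lime_ge; first exact: (ereal_nondecreasing_is_cvgn (ndU x)).
  by apply: nearW => n /=; rewrite lee_fin.
have h0 x : (0 <= h x)%E.
  apply: lime_ge; first exact: (ereal_nondecreasing_is_cvgn (ndh x)).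
  by apply: nearW => n; rewrite lee_fin sqr_ge0.
have hb : (\int[mu]_x h x <= b%:E)%E.
  rewrite /h monotone_convergence//.
  - apply: lime_le; last exact: nearW.
    apply: ereal_nondecreasing_is_cvgn => n m nm.
    apply: ge0_le_integral => //.
    + by move=> x _; rewrite lee_fin sqr_ge0.
    + by apply/measurable_EFinP; exact: measurable_funX.
    + by apply/measurable_EFinP; exact: measurable_funX.
    + by move=> x _; exact: ndh.
  - by move=> n; apply/measurable_EFinP; exact: measurable_funX.
  - by move=> n x _; rewrite lee_fin sqr_ge0.
have ih : mu.-integrable setT h.
  apply/integrableP; split => //; apply: le_lt_trans (ltry b).
  by under eq_integral do rewrite gee0_abs//.
have cvu : {ae mu, forall x, u_ n x @[n --> \oo] --> u x}.
  have := integrable_ae measurableT ih; apply: filterS => x /(_ I) hx.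
  have /cvg_ex[/= l ul] : cvgn (u_ ^~ x).
    apply: nondecreasing_is_cvgn; first exact: nd.
    exists (1 + fine (h x)) => _ [n _ <-].
    have : (((u_ n x) ^+ 2)%:E <= h x)%E.
      apply: lime_ge; first exact: (ereal_nondecreasing_is_cvgn (ndh x)).
      by exists n => // m /= nm; exact: ndh.
    by rewrite -(fineK hx) lee_fin; nra.
  suff -> : u x = l by [].
  rewrite /u (_ : U x = l%:E)//; apply: cvg_lim => //.
  by apply: cvg_EFin => //; exact: nearW.
exists u; split => //; last by move=> x; exact: fine_ge0.
apply/Lfun2P; split => //; apply/integrableP; split.
  by apply/measurable_EFinP; exact: measurable_funX.
rewrite (@ge0_ae_eq_integral _ _ _ _ _ _ h)//.
- exact: le_lt_trans hb (ltry b).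
- apply: measurableT_comp => //.
  by apply/measurable_EFinP; exact: measurable_funX.
move: cvu; apply: filterS => x ux _ /=.
rewrite ger0_norm ?sqr_ge0//; apply/esym/cvg_lim => //.
by apply: cvg_EFin; [exact: nearW|exact: (cvgM ux ux)].
Qed.

(** * Integration over products *)

Lemma integral_prod_swap d (T : measurableType d) (R : realType)
    (mu : {sigma_finite_measure set T -> \bar R}) (F : T * T -> \bar R) :
  (mu \x mu)%E.-integrable setT F ->
  (mu \x mu)%E.-integrable setT (fun z => F (z.2, z.1)) /\
  (\int[mu \x mu]_z F (z.2, z.1) = \int[mu \x mu]_z F z)%E.
Proof.
move=> iF; have mF := measurable_int _ iF.
have mS : measurable_fun setT (fun z => F (z.2, z.1)).
  exact: (measurableT_comp mF (@measurable_swap _ _ T T)).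
have iS : (mu \x mu)%E.-integrable setT (fun z => F (z.2, z.1)).
  by apply/integrable21ltyP => //=; exact/(integrable12ltyP _ _ mF).
split => //; rewrite -integral12_prod_meas1// -integral21_prod_meas1//.
Qed.

(** Tonelli's theorem holds on the whole product space; the restrictions to [A]
    and [B] are moved into the integrand as indicator functions. *)
Lemma tonelli_rectangle d (T : measurableType d) (R : realType)
    (mu : {sigma_finite_measure set T -> \bar R}) (A B : set T)
    (F : T * T -> R) : measurable A -> measurable B ->
  measurable_fun setT F -> (forall z, 0 <= F z) ->
  (\int[mu]_(x in A) \int[mu]_(y in B) (F (x, y))%:E =
   \int[mu]_(y in B) \int[mu]_(x in A) (F (x, y))%:E)%E.
Proof.
move=> mA mB mF F0.
have mkB (D : set T) (f : T -> R) :
    (\int[mu]_(y in D) (f y)%:E = \int[mu]_y (\1_D y * f y)%:E)%E.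
  rewrite integral_mkcond; apply: eq_integral => y _.
  by rewrite patchE indicE; case: ifP; rewrite ?mul1r ?mul0r.
have mkA (D : set T) (f : T -> \bar R) :
    (\int[mu]_(x in D) f x = \int[mu]_x ((\1_D x)%:E * f x))%E.
  rewrite integral_mkcond; apply: eq_integral => x _.
  by rewrite patchE indicE; case: ifP; rewrite ?mul1e ?mul0e.
have pull (D1 D2 : set T) (f : T -> T -> R) : measurable D2 ->
    (forall x, measurable_fun setT (f x)) -> (forall x y, 0 <= f x y) ->
    (\int[mu]_(x in D1) \int[mu]_(y in D2) (f x y)%:E =
     \int[mu]_x \int[mu]_y (\1_D1 x * (\1_D2 y * f x y))%:E)%E.
  move=> mD2 mf f0; rewrite mkA; apply: eq_integral => x _.
  rewrite mkB -ge0_integralZl//.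
  - by apply/measurable_EFinP; exact: measurable_funM.
  - by move=> y _; rewrite lee_fin mulr_ge0.
have mF1 x : measurable_fun setT (fun y => F (x, y)).
  exact: (measurableT_comp mF (pair1_measurable x)).
have mF2 y : measurable_fun setT (fun x => F (x, y)).
  exact: (measurableT_comp mF (pair2_measurable y)).
have F0' x y : 0 <= F (x, y) by exact: F0.
have F0'' x y : 0 <= F (y, x) by exact: F0.
rewrite [LHS](pull A B (fun x y => F (x, y)) mB mF1 F0').
rewrite [RHS](pull B A (fun y x => F (x, y)) mA mF2 F0'').
pose H (z : T * T) := (\1_A z.1 * (\1_B z.2 * F z))%:E.
have mH : measurable_fun setT H.
  apply/measurable_EFinP; apply: measurable_funM; first exact: measurableT_comp.
  by apply: measurable_funM => //; exact: measurableT_comp.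
have H0 z : (0 <= H z)%E by rewrite lee_fin !mulr_ge0.
rewrite [LHS](fubini_tonelli H mH H0).
by apply: eq_integral => y _; apply: eq_integral => x _; rewrite /H/= mulrCA.
Qed.

(** * The nonlocal Dirichlet form and Green's formula *)

Section nonlocal_form.
Context d (T : measurableType d) (R : realType).
Variable mu : {sigma_finite_measure set T -> \bar R}.
Variables (k : T -> T -> R) (M : R).
Hypothesis mk : measurable_fun setT (fun z : T * T => k z.1 z.2).
Hypothesis M0 : 0 < M.
Hypothesis k0 : forall x y, 0 <= k x y.
Hypothesis ksym : forall x y, k x y = k y x.
Hypothesis kM : forall x, (\int[mu]_y (k x y)%:E <= M%:E)%E.

Notation pmu := (mu \x mu)%E.

Lemma measurable_kernel_section x : measurable_fun setT (k x).
Proof. exact: (measurableT_comp mk (pair1_measurable x)). Qed.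

Lemma integrable_kernel_section x : mu.-integrable setT (EFin \o k x).
Proof.
apply/integrableP; split; first exact/measurable_EFinP/measurable_kernel_section.
apply: le_lt_trans (ltry M); apply: le_trans (kM x).
by under eq_integral do rewrite /= ger0_norm//.
Qed.

(** Integrating first in the variable that [g] does not see costs a factor of
    at most [M]. *)
Lemma integrable_kernel_fst (g : T -> R) : mu.-integrable setT (EFin \o g) ->
  pmu.-integrable setT (fun z => (k z.1 z.2 * g z.1)%:E).
Proof.
move=> /integrableP[/measurable_EFinP mg ig].
apply/integrable12ltyP => /=.
  apply/measurable_EFinP; apply: measurable_funM => //.
  exact: measurableT_comp.
apply: (@le_lt_trans _ _ (\int[mu]_x (M%:E * `|(g x)%:E|))%E); last first.
  rewrite ge0_integralZl//.
  - by rewrite lte_mul_pinfty// lee_fin ltW.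
  - by do 2 apply: measurableT_comp => //.
  - by rewrite lee_fin ltW.
apply: ge0_le_integral => //.
- by move=> x _; exact: integral_ge0.
- apply: (measurable_fun_fubini_tonelli_F (fun z => `|(k z.1 z.2 * g z.1)%:E|%E)) => //=.
  apply/measurable_EFinP; apply: measurableT_comp => //.
  by apply: measurable_funM => //; exact: measurableT_comp.
- by apply: measurable_funeM; do 2 apply: measurableT_comp => //.
- move=> x _; under eq_integral do rewrite /= normrM EFinM ger0_norm//.
  rewrite ge0_integralZr//.
  - by apply: lee_wpmul2r.
  - by apply/measurable_EFinP/measurable_kernel_section.
  - by move=> y _; rewrite lee_fin.
Qed.

Lemma integrable_kernel_snd (g : T -> R) : mu.-integrable setT (EFin \o g) ->
  pmu.-integrable setT (fun z => (k z.1 z.2 * g z.2)%:E).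
Proof.
move=> /integrable_kernel_fst /integral_prod_swap[+ _] /=.
by under eq_fun do rewrite ksym.
Qed.

(** Every integrability on the product comes from this bound: products of two
    values of square-integrable functions are at most sums of squares. *)
Lemma integrable_kernelM (F : T * T -> R) (g : T -> R) :
  measurable_fun setT F -> mu.-integrable setT (EFin \o g) ->
  (forall z, `|F z| <= g z.1 + g z.2) ->
  pmu.-integrable setT (fun z => (k z.1 z.2 * F z)%:E).
Proof.
move=> mF ig Fg.
apply: (@le_integrable _ _ _ _ _ measurableT _ (fun z =>
  (k z.1 z.2 * g z.1)%:E + (k z.1 z.2 * g z.2)%:E)%E) => //.
- by apply/measurable_EFinP; exact: measurable_funM.
- move=> z _; rewrite -EFinD -mulrDr /= lee_fin !normrM ler_wpM2l//.
  by rewrite (le_trans (Fg z))// ler_norm.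
- apply: integrableD => //; first exact: integrable_kernel_fst.
  exact: integrable_kernel_snd.
Qed.

(** [L u x] makes sense at almost every [x] although [u] need not be integrable:
    [|u| <= 1 + u^2], where [k x] is integrable and [k x * u^2] is so for almost
    every [x] by Fubini's theorem. *)
Lemma integrable_kernel_slice (u : T -> R) : u \in Lfun mu 2%:E ->
  {ae mu, forall x, mu.-integrable setT (fun y => (k x y * u y)%:E)}.
Proof.
move=> /Lfun2P[mu_ /integrable_kernel_snd iu].
have := ae_integrable1 iu; apply: filterS => x /= ix.
have ik := integrable_kernel_section x.
apply: (@le_integrable _ _ _ _ _ measurableT _
  (fun y => (k x y)%:E + (k x y * u y ^+ 2)%:E)%E) => //.
- apply/measurable_EFinP; apply: measurable_funM => //.
  exact: measurable_kernel_section.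
- move=> y _; rewrite -EFinD /= lee_fin -[X in X + _]mulr1 -mulrDr !normrM ler_wpM2l//.
  by rewrite ler_normr; apply/orP; left; rewrite ler_norml; nra.
- exact: integrableD.
Qed.

Lemma integrable_jump (u : T -> R) : u \in Lfun mu 2%:E ->
  {ae mu, forall x, mu.-integrable setT (fun y => (k x y * (u y - u x))%:E)}.
Proof.
move/integrable_kernel_slice; apply: filterS => x iu.
under eq_fun do rewrite mulrBr EFinB (mulrC (k x _) (u x)).
exact: integrableB iu
  (integrableZl measurableT (u x) (integrable_kernel_section x)).
Qed.

Section forms.
Variables u v : T -> R.
Hypotheses (u2 : u \in Lfun mu 2%:E) (v2 : v \in Lfun mu 2%:E).
Let mu_ := Lfun2_measurable u2.
Let mv := Lfun2_measurable v2.

Lemma integrable_dirichlet : pmu.-integrable setT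
  (fun z => (k z.1 z.2 * ((u z.2 - u z.1) * (v z.2 - v z.1)))%:E).
Proof.
have /Lfun2P[_ iu] := u2; have /Lfun2P[_ iv] := v2.
apply: (integrable_kernelM (g := fun x => u x ^+ 2 + v x ^+ 2)).
- by apply: measurable_funM; apply: measurable_funB; exact: measurableT_comp.
- exact: integrableD iu iv.
- move=> z; rewrite ler_norml.
  have := sqr_ge0 (u z.2 + u z.1); have := sqr_ge0 (v z.2 + v z.1).
  have := sqr_ge0 (u z.2 - u z.1 - (v z.2 - v z.1)).
  have := sqr_ge0 (u z.2 - u z.1 + (v z.2 - v z.1)).
  by move=> *; apply/andP; split; nra.
Qed.

Lemma integrable_weak : pmu.-integrable setT
  (fun z => (k z.1 z.2 * ((u z.2 - u z.1) * v z.1))%:E).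
Proof.
have /Lfun2P[_ iu] := u2; have /Lfun2P[_ iv] := v2.
apply: (integrable_kernelM (g := fun x => 2 * (u x ^+ 2 + v x ^+ 2))).
- apply: measurable_funM; last exact: measurableT_comp.
  by apply: measurable_funB; exact: measurableT_comp.
- exact: (integrableZl measurableT 2 (integrableD measurableT iu iv)).
- move=> z; rewrite ler_norml.
  have := sqr_ge0 (u z.2 + u z.1).
  have := sqr_ge0 (u z.2 - u z.1 - v z.1).
  have := sqr_ge0 (u z.2 - u z.1 + v z.1).
  have := sqr_ge0 (v z.1); have := sqr_ge0 (v z.2).
  by move=> *; apply/andP; split; nra.
Qed.
End forms.

(** The nonlocal Dirichlet form, as an integral over pairs of points. *)
Definition dform (u v : T -> R) : R :=
  (\int[pmu]_z (k z.1 z.2 * ((u z.2 - u z.1) * (v z.2 - v z.1))))%R.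

(** Green's formula.  Splitting [v y - v x] gives two integrals, which the
    exchange of the two variables and the symmetry of [k] identify. *)
Lemma dformE (u v : T -> R) : u \in Lfun mu 2%:E -> v \in Lfun mu 2%:E ->
  (dform u v)%:E =
  (- 2%:E * \int[mu]_x \int[mu]_y (k x y * ((u y - u x) * v x))%:E)%E.
Proof.
move=> u2 v2; have iw := integrable_weak u2 v2.
have [iS eS] := integral_prod_swap iw.
rewrite [X in (_ * X)%E](_ : _ = \int[pmu]_z
   (k z.1 z.2 * ((u z.2 - u z.1) * v z.1))%:E)%E; last first.
  by rewrite -integral12_prod_meas1.
rewrite /dform /Rintegral fineK; last first.
  by apply: integrable_fin_num => //; exact: integrable_dirichlet.
transitivity (\int[pmu]_z (- (k z.2 z.1 * ((u z.1 - u z.2) * v z.2))%:E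
   - (k z.1 z.2 * ((u z.2 - u z.1) * v z.1))%:E))%E.
  apply: eq_integral => z _; rewrite (ksym z.2) -!EFinN -EFinD; congr EFin.
  by ring.
rewrite integralB//; last exact: integrableN.
rewrite integralN/=; last exact: integrable_add_def.
have If := integrable_fin_num measurableT iw.
by rewrite eS -(fineK If) -!EFinN -EFinD -EFinM; congr EFin; ring.
Qed.

Lemma dform_ge0 u : 0 <= dform u u.
Proof.
by apply: Rintegral_ge0 => z _; rewrite mulr_ge0// -expr2 sqr_ge0.
Qed.

(** Second-order expansion of the quadratic form around [u]. *)
Lemma dformB u v : u \in Lfun mu 2%:E -> v \in Lfun mu 2%:E ->
  dform v v = dform u u + 2 * dform u (fun x => v x - u x)
    + dform (fun x => v x - u x) (fun x => v x - u x).
Proof.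
move=> u2 v2; set w := fun x => v x - u x.
have w2 : w \in Lfun mu 2%:E by exact: Lfun2B.
have I := integrable_dirichlet.
have iuu := I _ _ u2 u2; have iuw := I _ _ u2 w2; have iww := I _ _ w2 w2.
have iuw2 := integrableZl measurableT 2 iuw.
rewrite /dform -RintegralZl//.
rewrite -RintegralD// -RintegralD//; last exact: integrableD iuu iuw2.
by apply: eq_Rintegral => z _; rewrite /w; ring.
Qed.

Variable Omega : set T.

Definition solution (f u : T -> R) := {ae mu, forall x, Omega x ->
  (f x)%:E = (\int[mu]_y (k x y * (u y - u x))%:E)%E}.

Definition vanishing (u : T -> R) := {ae mu, forall x, ~ Omega x -> u x = 0}.

Lemma dform_solution f u v : f \in Lfun mu 2%:E -> u \in Lfun mu 2%:E ->
  v \in Lfun mu 2%:E -> vanishing v -> solution f u ->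
  dform u v = - 2 * (\int[mu]_x (f x * v x))%R.
Proof.
move=> f2 u2 v2 v0 fu; apply: EFin_inj.
rewrite (dformE u2 v2) EFinM EFinN; congr (_ * _)%E.
have ifv := Lfun2_mul_integrable f2 v2.
rewrite /Rintegral fineK; last exact: integrable_fin_num.
apply: ae_eq_integral => //.
- exact: measurable_int (integrable_fubini_F (integrable_weak u2 v2)).
- exact: measurable_int ifv.
have := integrable_jump u2.
move: v0 fu; apply: filterS3 => x v0 fu iu _ /=.
have [Ox|/v0 ->] := pselect (Omega x); last first.
  by under eq_integral do rewrite !mulr0; rewrite integral0 mulr0.
rewrite EFinM fu// -integralZr//.
by apply: eq_integral => y _; rewrite -EFinM mulrA.
Qed.

Lemma integral_vanishing f v : measurable Omega -> f \in Lfun mu 2%:E ->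
  v \in Lfun mu 2%:E -> vanishing v ->
  (\int[mu]_(x in Omega) (f x * v x)%:E)%E = (\int[mu]_x (f x * v x))%R%:E.
Proof.
move=> mO f2 v2 v0; have ifv := Lfun2_mul_integrable f2 v2.
have mfv := measurable_int _ ifv.
rewrite /Rintegral fineK; last exact: integrable_fin_num.
rewrite [LHS]integral_mkcond; apply: ae_eq_integral => //.
  exact/(measurable_restrictT _ mO)/(measurable_funTS mfv).
move: v0; apply: filterS => x v0 _; rewrite patchE.
by case: ifPn => // /negP; rewrite inE => /v0 ->; rewrite mulr0.
Qed.

(** The energy as a real number, for the kernel [k]. *)
Definition potential (f v : T -> R) : R :=
  dform v v / 4 + (\int[mu]_x (f x * v x))%R.

(** The cross term of [dformB] is [- \int f (v - u)] by Green's formula tested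
    with [v - u], and cancels the change of the linear term. *)
Lemma potential_solution f u v : f \in Lfun mu 2%:E -> u \in Lfun mu 2%:E ->
  vanishing u -> solution f u -> v \in Lfun mu 2%:E -> vanishing v ->
  potential f v = potential f u
    + dform (fun x => v x - u x) (fun x => v x - u x) / 4.
Proof.
move=> f2 u2 u0 fu v2 v0.
have w2 := Lfun2B v2 u2.
have w0 : vanishing (fun x => v x - u x).
  by move: u0 v0; apply: filterS2 => x u0 v0 nO; rewrite u0// v0// subrr.
rewrite /potential (dformB u2 v2) (dform_solution f2 u2 w2 w0 fu).
have ifu := Lfun2_mul_integrable f2 u2; have ifw := Lfun2_mul_integrable f2 w2.
rewrite (_ : \int[mu]_x (f x * v x) = \int[mu]_x (f x * u x)
    + \int[mu]_x (f x * (v x - u x)))%R; last first.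
  by rewrite -RintegralD//; apply: eq_Rintegral => x _; ring.
by field.
Qed.

(** * Sets on which the form controls the L^2 norm *)

Lemma dform_tonelli (v : T -> R) : v \in Lfun mu 2%:E ->
  (dform v v)%:E = (\int[mu]_x \int[mu]_y (k x y * (v y - v x) ^+ 2)%:E)%E.
Proof.
move=> v2; have iv := integrable_dirichlet v2 v2.
rewrite /dform /Rintegral fineK; last exact: integrable_fin_num.
by rewrite -integral12_prod_meas1//.
Qed.

(** Integrate [v(x)^2 <= 2 (v y - v x)^2 + 2 v(y)^2] over U x Q, where
    [(v y - v x)^2 <= k x y * (v y - v x)^2 / c]. *)
Lemma sqr_transfer (U Q : set T) (c : R) (v : T -> R) :
  measurable U -> measurable Q -> 0 < c ->
  (forall x y, U x -> Q y -> c <= k x y) -> v \in Lfun mu 2%:E ->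
  (mu Q * \int[mu]_(x in U) (v x ^+ 2)%:E <=
   (2 / c * dform v v)%:E + 2%:E * mu U * \int[mu]_(x in Q) (v x ^+ 2)%:E)%E.
Proof.
move=> mU mQ c0 ck v2; have mv := Lfun2_measurable v2.
have mv2 D : measurable_fun D (fun x => (v x ^+ 2)%:E).
  exact: Lfun2_measurable_sqr v2.
have mj x D : measurable_fun D (fun y => (2 / c * (k x y * (v y - v x) ^+ 2))%:E).
  apply: measurable_funTS; apply/measurable_EFinP.
  apply: measurable_funM => //; apply: measurable_funM.
    exact: measurable_kernel_section.
  by apply: measurable_funX; exact: measurable_funB.
have j0 x y : 0 <= k x y * (v y - v x) ^+ 2 by rewrite mulr_ge0// sqr_ge0.
have c2 : 0 <= 2 / c by rewrite divr_ge0// ltW.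
have mJ D : measurable_fun D
    (fun x => \int[mu]_y (2 / c * (k x y * (v y - v x) ^+ 2))%:E)%E.
  apply: measurable_funTS; apply: (measurable_fun_fubini_tonelli_F
    (fun z => (2 / c * (k z.1 z.2 * (v z.2 - v z.1) ^+ 2))%:E)) => /=; last first.
    by move=> z; rewrite lee_fin mulr_ge0.
  apply/measurable_EFinP; apply: measurable_funM => //; apply: measurable_funM => //.
  by apply: measurable_funX; apply: measurable_funB; exact: measurableT_comp.
pose I := (\int[mu]_(y in Q) (v y ^+ 2)%:E)%E.
have I0 : (0 <= I)%E by apply: integral_ge0 => y _; rewrite lee_fin sqr_ge0.
rewrite muleC -ge0_integralZr//; last by move=> x _; rewrite lee_fin sqr_ge0.
apply: (@le_trans _ _ (\int[mu]_(x in U)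
    (\int[mu]_y (2 / c * (k x y * (v y - v x) ^+ 2))%:E + 2%:E * I))%E).
  apply: ge0_le_integral => //.
  - by move=> x _; rewrite mule_ge0// lee_fin sqr_ge0.
  - by apply: emeasurable_funM => //; exact: measurable_cst.
  - by apply: emeasurable_funD => //; exact: measurable_cst.
  move=> x Ux; rewrite -integral_cst//.
  apply: (@le_trans _ _ (\int[mu]_(y in Q)
      ((2 / c * (k x y * (v y - v x) ^+ 2))%:E + 2%:E * (v y ^+ 2)%:E))%E).
    apply: ge0_le_integral => //.
    - by move=> y _; rewrite lee_fin sqr_ge0.
    - by apply: emeasurable_funD => //; exact: measurable_funeM.
    move=> y Qy; rewrite -EFinM -EFinD lee_fin.
    have : (v y - v x) ^+ 2 <= c^-1 * (k x y * (v y - v x) ^+ 2).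
      by rewrite mulrA ler_peMl ?sqr_ge0// -ler_pdivrMl ?invr_gt0// invrK mulr1 ck.
    (* (2 v(y) - v(x))^2 >= 0 is v(x)^2 <= 2 (v(y) - v(x))^2 + 2 v(y)^2. *)
    have := sqr_ge0 (2 * v y - v x); nra.
  rewrite ge0_integralD//; last 3 first.
  - by move=> y _; rewrite lee_fin mulr_ge0.
  - by move=> y _; rewrite -EFinM lee_fin mulr_ge0// sqr_ge0.
  - exact: measurable_funeM.
  rewrite ge0_integralZl//; last by move=> y _; rewrite lee_fin sqr_ge0.
  rewrite leeD2r//; apply: ge0_subset_integral => //.
  by move=> y _; rewrite lee_fin mulr_ge0.
rewrite ge0_integralD//; last 2 first.
- by move=> x _; apply: integral_ge0 => y _; rewrite lee_fin mulr_ge0.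
- by move=> x _; rewrite mule_ge0.
rewrite integral_cst// muleAC leeD2r// EFinM dform_tonelli//.
rewrite -ge0_integralZl//; last 2 first.
- apply: (measurable_fun_fubini_tonelli_F
    (fun z => (k z.1 z.2 * (v z.2 - v z.1) ^+ 2)%:E)) => /=; last first.
    by move=> z; rewrite lee_fin.
  apply/measurable_EFinP; apply: measurable_funM => //.
  by apply: measurable_funX; apply: measurable_funB; exact: measurableT_comp.
- by move=> x _; apply: integral_ge0 => y _; rewrite lee_fin.
under [leRHS]eq_integral => x _.
  rewrite -ge0_integralZl//; last 2 first.
  - apply/measurable_EFinP; apply: measurable_funM.
      exact: measurable_kernel_section.
    by apply: measurable_funX; exact: measurable_funB.
  - by move=> y _; rewrite lee_fin.
  over.
apply: ge0_subset_integral => //.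
by move=> x _; apply: integral_ge0 => y _; rewrite lee_fin mulr_ge0.
Qed.

(** The local form of the Poincare inequality; the constant may depend on [U]
    but not on [v]. *)
Definition controlled (U : set T) := exists C : R, forall v,
  v \in Lfun mu 2%:E -> vanishing v ->
  (\int[mu]_(x in U) (v x ^+ 2)%:E <= (C * dform v v)%:E)%E.

Lemma controlled_subset (U V : set T) : measurable U -> measurable V ->
  U `<=` V -> controlled V -> controlled U.
Proof.
move=> mU mV UV [C CP]; exists C => v v2 v0; apply: le_trans (CP v v2 v0).
apply: ge0_subset_integral => //; first exact: (Lfun2_measurable_sqr v2).
by move=> x _; rewrite lee_fin sqr_ge0.
Qed.

Lemma controlled_setU (U V : set T) : measurable U -> measurable V ->
  controlled U -> controlled V -> controlled (U `|` V).
Proof.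
move=> mU mV [C CP] cV.
have mVU : measurable (V `\` U) by exact: measurableD.
have [D DP] := controlled_subset mVU mV (@subDsetl _ V U) cV.
exists (C + D) => v v2 v0.
have -> : U `|` V = U `|` (V `\` U).
  by apply/seteqP; split=> x /=; have [] := pselect (U x); tauto.
rewrite ge0_integral_setU//=.
- by rewrite mulrDl EFinD leeD ?CP ?DP.
- exact: (Lfun2_measurable_sqr v2).
- by move=> x _; rewrite lee_fin sqr_ge0.
- by apply/disj_setPS => x [? []].
Qed.

Lemma controlled_off (U : set T) : measurable U -> U `&` Omega = set0 ->
  controlled U.
Proof.
move=> mU UO; exists 0 => v v2 v0; rewrite mul0r.
rewrite (ge0_ae_eq_integral (g := cst 0%E) mU)//.
- by rewrite integral0.
- exact: (Lfun2_measurable_sqr v2).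
- by move=> x _; rewrite lee_fin sqr_ge0.
move: v0; apply: filterS => x vx Ux; rewrite vx ?expr0n// => Ox.
by have : (U `&` Omega) x by []; rewrite UO.
Qed.

Lemma controlled_transfer (U Q : set T) (c : R) :
  measurable U -> measurable Q -> (mu U < +oo)%E -> (mu Q < +oo)%E ->
  (0 < mu Q)%E -> 0 < c -> (forall x y, U x -> Q y -> c <= k x y) ->
  controlled Q -> controlled U.
Proof.
move=> mU mQ fU fQ Q0 c0 ck [C CP].
have fU' : mu U \is a fin_num by rewrite ge0_fin_numE.
have fQ' : mu Q \is a fin_num by rewrite ge0_fin_numE.
have q0 : 0 < fine (mu Q) by apply: fine_gt0; rewrite Q0.
exists ((fine (mu Q))^-1 * (2 / c + 2 * (fine (mu U) * C))) => v v2 v0.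
rewrite -[X in (_ <= X%:E)%E]mulrA [leRHS]EFinM lee_pdivlMl// fineK//.
apply: le_trans (sqr_transfer mU mQ c0 ck v2) _.
rewrite [X in (_ <= X%:E)%E]mulrDl [leRHS]EFinD leeD2l// -(fineK fU') -EFinM.
have -> : 2 * (fine (mu U) * C) * dform v v = 2 * fine (mu U) * (C * dform v v).
  by ring.
rewrite [leRHS]EFinM.
by apply: lee_wpmul2l; [rewrite lee_fin mulr_ge0// fine_ge0|exact: CP].
Qed.

(** * Consequences of coercivity: minimality and uniqueness *)

Hypothesis coercive : exists C : R, forall v, v \in Lfun mu 2%:E ->
  vanishing v -> (\int[mu]_x (v x ^+ 2) <= C * dform v v)%R.

Lemma dform_le0_ae v : v \in Lfun mu 2%:E -> vanishing v -> dform v v <= 0 ->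
  {ae mu, forall x, v x = 0}.
Proof.
move=> v2 v0 dv; have [C /(_ v v2 v0) vC] := coercive.
have /Lfun2P[mv iv] := v2.
have d0 : dform v v = 0 by apply/eqP; rewrite eq_le dv dform_ge0.
have mv2 : measurable_fun setT (EFin \o (fun x => v x ^+ 2)).
  exact: measurable_int iv.
have : (\int[mu]_x `|(v x ^+ 2)%:E| = 0)%E.
  under eq_integral do rewrite gee0_abs ?lee_fin ?sqr_ge0//.
  rewrite -(fineK (integrable_fin_num measurableT iv)); congr EFin.
  apply/eqP; rewrite eq_le; apply/andP; split.
    by apply: le_trans vC _; rewrite d0 mulr0.
  by apply: fine_ge0; apply: integral_ge0 => x _; rewrite lee_fin sqr_ge0.
move/(ae_eq_integral_abs mu measurableT mv2); apply: filterS => x /= /(_ I).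
by move=> [] /eqP; rewrite sqrf_eq0 => /eqP.
Qed.

Section consequences.
Variables f u : T -> R.
Hypotheses (f2 : f \in Lfun mu 2%:E) (u2 : u \in Lfun mu 2%:E).
Hypotheses (u0 : vanishing u) (fu : solution f u).

Lemma solution_minimizes v : v \in Lfun mu 2%:E -> vanishing v ->
  potential f u <= potential f v.
Proof.
move=> v2 v0; rewrite (potential_solution f2 u2 u0 fu v2 v0).
by rewrite lerDl divr_ge0// dform_ge0.
Qed.

Lemma minimizer_eq_solution v : v \in Lfun mu 2%:E -> vanishing v ->
  potential f v <= potential f u -> v = u %[ae mu].
Proof.
move=> v2 v0; rewrite (potential_solution f2 u2 u0 fu v2 v0) gerDl => dv.
have : {ae mu, forall x, v x - u x = 0}.
  apply: (@dform_le0_ae (fun x => v x - u x)); [exact: Lfun2B| |lra].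
  by move: u0 v0; apply: filterS2 => x u0' v0' nO; rewrite u0'// v0'// subrr.
by apply: filterS => x /eqP; rewrite subr_eq0 => /eqP ? _.
Qed.
End consequences.

(** * Existence by monotone iteration *)

Hypothesis mOmega : measurable Omega.
Hypothesis fOmega : (mu Omega < +oo)%E.

Definition integral_op (u : T -> R) (x : T) : R := (\int[mu]_y (k x y * u y))%R.

(** The iterates are kept bounded so that all their integrals against the kernel
    are finite real numbers at every point. *)
Definition bounded_nonneg (u : T -> R) :=
  measurable_fun setT u /\ exists C, forall x, 0 <= u x <= C.

Lemma integrable_integral_op u x : bounded_nonneg u ->
  mu.-integrable setT (EFin \o (fun y => k x y * u y)).
Proof.
move=> [mu_ [C uC]]; have mkx := measurable_kernel_section x.
apply: (@le_integrable _ _ _ _ _ measurableT _ (fun y => C%:E * (k x y)%:E)%E).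
- by apply/measurable_EFinP; exact: measurable_funM.
- move=> y _; rewrite -EFinM /= lee_fin mulrC !normrM ler_wpM2r//.
  have /andP[u0 uC'] := uC y.
  by rewrite ger0_norm// (le_trans uC')// ler_norm.
- exact: (integrableZl measurableT C (integrable_kernel_section x)).
Qed.

Lemma integral_op_ge0 u x : bounded_nonneg u -> 0 <= integral_op u x.
Proof.
move=> [_ [C uC]]; apply: Rintegral_ge0 => y _; rewrite mulr_ge0//.
by have /andP[] := uC y.
Qed.

Lemma le_integral_op u v x : bounded_nonneg u -> bounded_nonneg v ->
  (forall y, u y <= v y) -> integral_op u x <= integral_op v x.
Proof.
move=> bu bv uv; apply: le_Rintegral => //; [exact: integrable_integral_op..|].
by move=> y _; rewrite ler_wpM2l.
Qed.

Lemma measurable_integral_op u : bounded_nonneg u -> measurable_fun setT (integral_op u).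
Proof.
move=> [mu_ [C uC]]; rewrite /integral_op /Rintegral.
apply: (measurableT_comp (@fine_measurable R setT measurableT)).
apply: (measurable_fun_fubini_tonelli_F
  (fun z => (k z.1 z.2 * u z.2)%:E)) => /=.
  apply/measurable_EFinP; apply: measurable_funM => //.
  exact: measurableT_comp.
by move=> z; rewrite lee_fin mulr_ge0//; have /andP[] := uC z.2.
Qed.

Lemma bounded_nonneg_cst c : 0 <= c -> bounded_nonneg (cst c).
Proof. by move=> c0; split => //; exists c => x; rewrite c0 lexx. Qed.

Lemma integral_op_cst c x : integral_op (cst c) x = c * integral_op (cst 1) x.
Proof.
rewrite /integral_op -RintegralZl//; last first.
  by apply: integrable_integral_op; exact: bounded_nonneg_cst.
by apply: eq_Rintegral => y _ /=; rewrite mulr1 mulrC.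
Qed.

Lemma integral_op1_le x : integral_op (cst 1) x <= M.
Proof.
rewrite -lee_fin (le_trans _ (kM x))// /integral_op /Rintegral fineK.
  by under eq_integral do rewrite /= mulr1.
apply: integrable_fin_num => //; apply: integrable_integral_op.
exact: bounded_nonneg_cst.
Qed.

(** One step of a damped Jacobi iteration for [m u - \int k u = g] on Omega,
    where [m x] is the mass of [k x].  Damping by the bound [M >= m] makes
    the coefficient of [u x] nonnegative, hence the step monotone in [u]. *)
Definition relax (g u : T -> R) (x : T) : R :=
  \1_Omega x * (((M - integral_op (cst 1) x) * u x + integral_op u x + g x) / M).

Lemma bounded_nonneg_relax g u : bounded_nonneg g -> bounded_nonneg u ->
  bounded_nonneg (relax g u).
Proof.
move=> bg bu; have [mg [C gC]] := bg; have [mu_ [D uD]] := bu.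
have m1 := measurable_integral_op (bounded_nonneg_cst ler01).
split.
  apply: measurable_funM => //; apply: measurable_funM => //.
  apply: measurable_funD => //; apply: measurable_funD.
    by apply: measurable_funM => //; exact: measurable_funB.
  exact: measurable_integral_op.
exists ((M * D + D * M + C) / M) => x.
have /andP[g0 gC'] := gC x; have /andP[u0 uD'] := uD x.
have a0 : 0 <= integral_op (cst 1) x := integral_op_ge0 x (bounded_nonneg_cst ler01).
have aM := integral_op1_le x; have au0 := integral_op_ge0 x bu.
have D0 : 0 <= D := le_trans u0 uD'.
have auD : integral_op u x <= D * integral_op (cst 1) x.
  rewrite -integral_op_cst; apply: le_integral_op => // [|y].
    exact: bounded_nonneg_cst.
  by have /andP[] := uD y.
rewrite /relax indicE; case: (x \in Omega); rewrite ?mul1r ?mul0r ?lexx/=.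
  by rewrite divr_ge0 ?ler_pM2r ?invr_gt0// ?(ltW M0)//; nra.
by rewrite divr_ge0 ?(ltW M0)//; nra.
Qed.

Lemma le_relax g g' u u' : bounded_nonneg u -> bounded_nonneg u' ->
  (forall x, g x <= g' x) -> (forall x, u x <= u' x) ->
  forall x, relax g u x <= relax g' u' x.
Proof.
move=> bu bu' gg uu x; rewrite /relax ler_wpM2l// ler_pM2r ?invr_gt0//.
rewrite lerD// lerD ?le_integral_op// ler_wpM2l// subr_ge0.
exact: integral_op1_le.
Qed.

Lemma bounded_nonneg_Lfun2 u : bounded_nonneg u ->
  (forall x, ~ Omega x -> u x = 0) -> u \in Lfun mu 2%:E.
Proof.
move=> [mu_ [C uC]] u0.
apply: (@le_Lfun2 _ _ _ _ _ (fun x => C * \1_Omega x)) => //.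
  move=> x; have /andP[ux0 uxC] := uC x; rewrite indicE.
  have [Ox|nOx] := pselect (Omega x).
    by rewrite mem_set// mulr1 !ger0_norm// (le_trans ux0).
  by rewrite memNset// u0// mulr0.
apply/Lfun2P; split.
  exact: measurable_funM.
rewrite (_ : _ \o _ = (fun x => (C ^+ 2)%:E * (\1_Omega x)%:E)%E).
  apply: integrableZl => //; apply/integrableP; split.
    exact/measurable_EFinP.
  under eq_integral do rewrite /= ger0_norm//.
  by rewrite integral_indic// setIT.
apply/funext => x /=; rewrite -EFinM; congr EFin.
by rewrite indicE; case: (x \in Omega); rewrite ?mulr1 ?mulr0 ?expr0n.
Qed.

(** Green's formula for a bounded function tested against itself, where [L u]
    splits at every point into its gain and loss parts. *)
Lemma dform_bounded u : bounded_nonneg u -> (forall x, ~ Omega x -> u x = 0) ->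
  mu.-integrable setT (EFin \o (fun x =>
    (integral_op (cst 1) x * u x - integral_op u x) * u x)) /\
  dform u u = 2 * (\int[mu]_x
    ((integral_op (cst 1) x * u x - integral_op u x) * u x))%R.
Proof.
move=> bu u0; have u2 := bounded_nonneg_Lfun2 bu u0.
have b1 := bounded_nonneg_cst ler01.
have inner x : (\int[mu]_y (k x y * ((u y - u x) * u x))%:E)%E =
   (- ((integral_op (cst 1) x * u x - integral_op u x) * u x))%:E.
  have iu := integrable_integral_op x bu; have i1 := integrable_integral_op x b1.
  transitivity ((\int[mu]_y (u x * (k x y * u y) - u x ^+ 2 * (k x y * cst 1 y)))%R%:E).
    rewrite /Rintegral fineK.
      by apply: eq_integral => y _; congr EFin; rewrite /=; ring.
    apply: integrable_fin_num => //.
    exact: (integrableB measurableT (integrableZl measurableT (u x) iu)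
      (integrableZl measurableT (u x ^+ 2) i1)).
  rewrite RintegralB// ?RintegralZl//.
  - by congr EFin; rewrite /integral_op; ring.
  - exact: (integrableZl measurableT (u x) iu).
  - exact: (integrableZl measurableT (u x ^+ 2) i1).
have iG : mu.-integrable setT (EFin \o (fun x =>
    - ((integral_op (cst 1) x * u x - integral_op u x) * u x))).
  have := integrable_fubini_F (integrable_weak u2 u2).
  by apply: eq_integrable => // x _; exact: inner.
have iP : mu.-integrable setT (EFin \o (fun x =>
    (integral_op (cst 1) x * u x - integral_op u x) * u x)).
  have := integrableN iG; apply: eq_integrable => // x _ /=.
  by rewrite opprK.
split=> //; apply: EFin_inj.
rewrite (dformE u2 u2) EFinM /Rintegral fineK; last first.
  exact: integrable_fin_num.
rewrite (_ : integral _ _ _ = - \int[mu]_x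
    ((integral_op (cst 1) x * u x - integral_op u x) * u x)%:E)%E; last first.
  rewrite -integralN/=; last exact: integrable_add_def.
  by apply: eq_integral => x _; exact: inner.
by rewrite muleNN.
Qed.

(** Testing [- L u <= f] with [u >= 0] gives
    [\int u^2 <= C (dform u u) <= 2 C \int f u], and the right-hand side is at
    most [\int u^2 / 2 + 2 C^2 \int f^2]. *)
Lemma subsolution_bound f : f \in Lfun mu 2%:E -> exists b, forall u,
  bounded_nonneg u -> (forall x, ~ Omega x -> u x = 0) ->
  (forall x, Omega x -> integral_op (cst 1) x * u x - integral_op u x <= f x) ->
  (\int[mu]_x (u x ^+ 2)%:E <= b%:E)%E.
Proof.
move=> f2; have [C0 C0P] := coercive; pose C := `|C0|.
have C_ge0 : 0 <= C by exact: normr_ge0.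
exists (4 * C ^+ 2 * (\int[mu]_x (f x ^+ 2))%R) => u bu u0 uf.
have u2 := bounded_nonneg_Lfun2 bu u0.
have [ig duE] := dform_bounded bu u0.
have /Lfun2P[_ iu] := u2; have /Lfun2P[_ iff] := f2.
have ifu := Lfun2_mul_integrable f2 u2.
have le1 : dform u u <= 2 * (\int[mu]_x (f x * u x))%R.
  rewrite duE ler_wpM2l//; apply: le_Rintegral => // x _.
  have ux0 : 0 <= u x by have [_ [D /(_ x)/andP[]]] := bu.
  have [Ox|/u0 ->] := pselect (Omega x); last by rewrite !mulr0.
  by rewrite ler_wpM2r// uf.
have le2 : (\int[mu]_x (u x ^+ 2))%R <= C * dform u u.
  apply: le_trans (C0P u u2 _) _; first exact: aeW.
  by rewrite ler_wpM2r ?dform_ge0// ler_norm.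
have le3 : (\int[mu]_x ((4 * C) * (f x * u x)))%R <=
    (\int[mu]_x (u x ^+ 2 + 4 * C ^+ 2 * f x ^+ 2))%R.
  apply: le_Rintegral => //.
  - exact: (integrableZl measurableT (4 * C) ifu).
  - exact: (integrableD measurableT iu (integrableZl measurableT (4 * C ^+ 2) iff)).
  - by move=> x _; have := sqr_ge0 (u x - 2 * C * f x); nra.
rewrite RintegralZl// RintegralD// in le3; last first.
  exact: (integrableZl measurableT (4 * C ^+ 2) iff).
rewrite RintegralZl// in le3.
rewrite -(fineK (integrable_fin_num measurableT iu)) lee_fin.
rewrite -/(Rintegral mu setT (fun x => u x ^+ 2)).
have le4 : C * dform u u <= C * (2 * (\int[mu]_x (f x * u x))%R).
  by rewrite ler_wpM2l.
by lra.
Qed.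

(** The iterates [u_ n] increase because the step is monotone and the truncated
    data [g n] increase with [n].  Since [u_ n <= u_ n.+1], each [u_ n] is a
    subsolution for [f], which bounds its norm uniformly in [n]. *)
Lemma solution_nonneg f : f \in Lfun mu 2%:E -> (forall x, 0 <= f x) ->
  exists u, [/\ u \in Lfun mu 2%:E, vanishing u &
    solution (fun x => - f x) u].
Proof.
move=> f2 f0; have [b bP] := subsolution_bound f2.
have mf := Lfun2_measurable f2.
pose g n (x : T) := Num.min (f x) n%:R.
pose u_ := fix u_ n := if n is n'.+1 then relax (g n') (u_ n') else cst 0.
have bg n : bounded_nonneg (g n).
  split; first exact: measurable_minr.
  by exists n%:R => x; rewrite le_min f0 ler0n ge_min lexx orbT.
have bu n : bounded_nonneg (u_ n).
  by elim: n => [|n IH]; [exact: bounded_nonneg_cst|exact: bounded_nonneg_relax].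
have gS n x : g n x <= g n.+1 x.
  by rewrite /g le_min ge_min lexx/= ge_min ler_nat leqnSn orbT.
have uS n : forall x, u_ n x <= u_ n.+1 x.
  elim: n => [x|n IH x]; last exact: (le_relax (bu n) (bu n.+1) (gS n) IH x).
  by have [_ [D /(_ x)/andP[]]] := bu 1%N.
have u0 n x : ~ Omega x -> u_ n x = 0.
  by case: n => // n nO /=; rewrite /relax indicE memNset// mul0r.
have uE n x : Omega x -> M * u_ n.+1 x =
    (M - integral_op (cst 1) x) * u_ n x + integral_op (u_ n) x + g n x.
  move=> Ox /=; rewrite /relax indicE mem_set// mul1r mulrC divfK//.
  by rewrite gt_eqF.
have ub n : (\int[mu]_x (u_ n x ^+ 2)%:E <= b%:E)%E.
  apply: bP => // [|x Ox]; first exact: u0.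
  have gf : g n x <= f x by rewrite /g ge_min lexx.
  have : M * u_ n x <= M * u_ n.+1 x by rewrite ler_pM2l.
  by rewrite uE//; lra.
have nd x : {homo u_ ^~ x : n m / (n <= m)%N >-> n <= m}.
  by apply/nondecreasing_seqP => n; exact: uS.
have u_ge0 n x : 0 <= u_ n x by have [_ [D /(_ x)/andP[]]] := bu n.
have [|u [u2 u_0 cu]] := Lfun2_monotone_limit _ u_ge0 nd ub.
  by move=> n; have [] := bu n.
have mu_ := Lfun2_measurable u2.
exists u; split=> //.
  move: cu; apply: filterS => x ux nO; apply: (norm_cvg_unique ux).
  rewrite (_ : (fun n => u_ n x) = cst 0); first exact: cvg_cst.
  by apply/funext => n; exact: u0.
have := integrable_kernel_slice u2.
move: (cu); apply: filterS2 => x ux iu Ox.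
have ku : (integral_op (u_ n) x)%:E @[n --> \oo] --> (\int[mu]_y (k x y * u y)%:E)%E.
  have mkx := measurable_kernel_section x.
  have mku n : measurable_fun setT (fun y => (k x y * u_ n y)%:E).
    by apply/measurable_EFinP; apply: measurable_funM => //; have [] := bu n.
  have ndk y : {homo (fun n => (k x y * u_ n y)%:E) : n m / (n <= m)%N >-> (n <= m)%E}.
    by move=> n m nm; rewrite lee_fin ler_wpM2l// nd.
  have := @cvg_monotone_convergence _ _ _ mu setT measurableT _ mku.
  rewrite (_ : integral _ _ _ = \int[mu]_y (k x y * u y)%:E)%E; last first.
    apply: ge0_ae_eq_integral => //.
    - apply: (emeasurable_fun_cvg _ _ mku) => y _.
      exact: (ereal_nondecreasing_is_cvgn (ndk y)).
    - by apply/measurable_EFinP; exact: measurable_funM.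
    - move=> y _; apply: lime_ge; first exact: (ereal_nondecreasing_is_cvgn (ndk y)).
      by apply: nearW => n; rewrite lee_fin mulr_ge0.
    - by move=> y _; rewrite lee_fin mulr_ge0.
    - move: cu; apply: filterS => y uy _; apply: cvg_lim => //.
      apply: cvg_EFin; first exact: nearW.
      by apply: cvgM => //; exact: cvg_cst.
  rewrite (_ : (fun n => (integral_op (u_ n) x)%:E) =
      (fun n => \int[mu]_y (k x y * u_ n y)%:E)%E); last first.
    apply/funext => n; rewrite /integral_op /Rintegral fineK//.
    exact: integrable_fin_num (integrable_integral_op x (bu n)).
  by apply => // n y _; rewrite lee_fin mulr_ge0.
(* The recursion expresses the integral of k(x, y) u_n(y) through the values at
   x alone, which converge. *)
have kl : integral_op (u_ n) x @[n --> \oo] --> integral_op (cst 1) x * u x - f x.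
  rewrite (_ : (fun n => _) = (fun n => M * u_ n.+1 x
      - (M - integral_op (cst 1) x) * u_ n x - g n x)); last first.
    by apply/funext => n; rewrite uE//; ring.
  rewrite (_ : _ - f x = M * u x - (M - integral_op (cst 1) x) * u x - f x); last by ring.
  apply: cvgB; last first.
    apply: cvg_near_cst; near=> n; rewrite /g; apply/min_idPl.
    by near: n; exact: nbhs_infty_ger.
  apply: cvgB; apply: cvgM => //; try exact: cvg_cst.
  by have := ux; rewrite -(cvg_shiftS (u_ ^~ x)).
have kE : (\int[mu]_y (k x y * u y)%:E = (integral_op (cst 1) x * u x - f x)%:E)%E.
  apply: (cvg_unique (@ereal_hausdorff R) ku).
  by apply: cvg_EFin => //; exact: nearW.
have ik := integrable_integral_op x (bounded_nonneg_cst ler01).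
transitivity (\int[mu]_y ((k x y * u y)%:E - (u x)%:E * (k x y * cst 1 y)%:E))%E.
  rewrite integralB//; last exact: (integrableZl measurableT (u x) ik).
  rewrite integralZl// kE -(fineK (integrable_fin_num measurableT ik)).
  rewrite -EFinM -EFinN -EFinD; congr EFin.
  by rewrite /integral_op /Rintegral; ring.
apply: eq_integral => y _; rewrite -EFinM -EFinN -EFinD; congr EFin.
by rewrite /=; ring.
Unshelve. all: by end_near. Qed.

Lemma solutionB f g u v : u \in Lfun mu 2%:E -> v \in Lfun mu 2%:E ->
  solution f u -> solution g v ->
  solution (fun x => f x - g x) (fun x => u x - v x).
Proof.
move=> u2 v2 fu gv.
have iu := integrable_jump u2.
have iv := integrable_jump v2.
have {}fu : {ae mu, forall x, Omega x ->
    mu.-integrable setT (fun y => (k x y * (u y - u x))%:E) /\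
    (f x)%:E = (\int[mu]_y (k x y * (u y - u x))%:E)%E}.
  by move: iu fu; apply: filterS2 => x iu fu Ox; split=> //; exact: fu.
move: fu iv gv; apply: filterS3 => x fu {}iv gv Ox; have [{}iu {}fu] := fu Ox.
rewrite EFinB fu gv// -integralB//; apply: eq_integral => y _.
by rewrite -EFinB; congr EFin; ring.
Qed.

Lemma solution_exists f : f \in Lfun mu 2%:E ->
  exists u, [/\ u \in Lfun mu 2%:E, vanishing u & solution f u].
Proof.
move=> f2; have mf := Lfun2_measurable f2.
have fp2 : (fun x => Num.max (f x) 0) \in Lfun mu 2%:E.
  apply: le_Lfun2 f2; first exact: measurable_maxr.
  by move=> x; rewrite /Num.max; case: ifP => //; rewrite normr0.
have fn2 : (fun x => Num.max (- f x) 0) \in Lfun mu 2%:E.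
  apply: le_Lfun2 f2.
    by apply: measurable_maxr => //; exact: measurable_funN.
  by move=> x; rewrite /Num.max; case: ifP => //; rewrite ?normr0 ?normrN.
have [|u [u2 u0 fu]] := solution_nonneg fp2.
  by move=> x; rewrite le_max lexx orbT.
have [|v [v2 v0 fv]] := solution_nonneg fn2.
  by move=> x; rewrite le_max lexx orbT.
exists (fun x => v x - u x); split; first exact: Lfun2B.
  by move: u0 v0; apply: filterS2 => x u0 v0 nO; rewrite u0// v0// subrr.
have := solutionB v2 u2 fv fu; apply: filterS => x + Ox => /(_ Ox) <-.
congr EFin; have [fx|/ltW fx] := leP 0 (f x).
  by rewrite max_r ?oppr_le0//; ring.
rewrite max_l ?oppr_ge0//; ring.
Qed.
End nonlocal_form.

(** * Measurability for the Lebesgue measure on R^N *)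

Section lebesgue_measurability.
Context (R : realType) (N : nat).
Notation E := 'rV[R]_N.+1.
Notation outer := (@lebesgue_outer R N).

Definition cut_below (c : E * E) (i : 'I_N.+1) (a : R) : E * E :=
  (c.1, \row_j if j == i then Num.min (c.2 ord0 j) a else c.2 ord0 j).
Definition cut_above (c : E * E) (i : 'I_N.+1) (a : R) : E * E :=
  (\row_j if j == i then Num.max (c.1 ord0 j) a else c.1 ord0 j, c.2).

Lemma box_volume_cut c i a :
  box_volume c = box_volume (cut_below c i a) + box_volume (cut_above c i a).
Proof.
rewrite /box_volume (bigD1 i)//= [X in _ = X + _](bigD1 i)//=.
rewrite [X in _ = _ + X](bigD1 i)//= !mxE eqxx.
under [X in _ = _ * X + _]eq_bigr => j /negbTE ji do rewrite mxE ji.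
under [X in _ = _ + _ * X]eq_bigr => j /negbTE ji do rewrite mxE ji.
rewrite -mulrDl; congr (_ * _).
move: (c.1 _ _) (c.2 _ _) => l r.
rewrite -[Num.max l a]opprK.
case: (leP r a) => ra; case: (leP l a) => la; rewrite opprK;
  repeat (case: (leP 0 _) => ?); lra.
Qed.

(** A hyperplane orthogonal to an axis cuts each box of a cover into two boxes
    whose volumes add up, so it splits the outer measure of any set. *)
Lemma measurable_halfspace (i : 'I_N.+1) (a : R) :
  measurable ([set x | x ord0 i <= a] : set (lebT R N)).
Proof.
apply: le_caratheodory_measurable => /= X.
apply: le_ereal_inf_tmp => _ [c Xc <-].
have vol0 c' k : (0 <= (box_volume (c' k : E * E))%:E)%E.
  by rewrite lee_fin box_volume_ge0.
apply: (@le_trans _ _ (\sum_(0 <= k <oo) (box_volume (cut_below (c k) i a))%:E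
    + \sum_(0 <= k <oo) (box_volume (cut_above (c k) i a))%:E)%E).
  apply: leeD; apply: ereal_inf_lbound.
    exists (fun k => cut_below (c k) i a) => // x [/Xc[k _ xk] /= xa].
    exists k => // j; rewrite /= mxE; have /andP[-> xj] := xk j.
    by case: eqP => // ->; rewrite le_min xa andbT; have /andP[] := xk i.
  exists (fun k => cut_above (c k) i a) => // x [/Xc[k _ xk] /= /negP xa].
  exists k => // j; rewrite /= mxE; have /andP[xj ->] := xk j.
  case: eqP => [->|_]; rewrite ?xj// andbT gt_max ltNge.
  by rewrite ltNge xa andbT -ltNge; have /andP[] := xk i.
rewrite -nneseriesD//.
by under eq_eseriesr do rewrite -EFinD -box_volume_cut.
Qed.

Lemma measurable_coordinate (i : 'I_N.+1) :
  measurable_fun setT ((fun x => x ord0 i) : lebT R N -> R).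
Proof.
apply: (measurability _ (RGenOInfty.measurableE R)) => _ [_ [a ->] <-].
rewrite setTI (_ : _ @^-1` _ = ~` [set x : lebT R N | x ord0 i <= a]).
  by apply: measurableC; exact: measurable_halfspace.
by apply/seteqP; split => x /=; rewrite in_itv/= andbT ltNge => /negP.
Qed.

Lemma ball_rowE (p : E) (e : R) : 0 < e ->
  ball p e = \bigcap_(i in [set: 'I_N.+1])
    ((fun x : E => x ord0 i) @^-1` ball (p ord0 i) e).
Proof.
move=> e0; apply/seteqP; split => [x [_ px] i _ /=|x px]; first exact: px.
by split => // i j; rewrite (ord1 i); exact: px.
Qed.

Lemma measurable_ball_row (p : E) (e : R) :
  measurable (ball p e : set (lebT R N)).
Proof.
have [e0|e0] := ltP 0 e; last first.
  by rewrite (_ : ball p e = set0)//; apply/seteqP; split => // x [];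
    rewrite ltNge e0.
rewrite ball_rowE//; apply: fin_bigcap_measurable => // i _.
rewrite -[X in measurable X]setTI; apply: measurable_coordinate => //.
exact: measurable_ball.
Qed.

End lebesgue_measurability.

(** * Open sets, sigma-finiteness and translation invariance *)

Section lebesgue_topology.
Context (R : realType) (N : nat).
Notation E := 'rV[R]_N.+1.
Notation outer := (@lebesgue_outer R N).

Lemma lebesgue_outer_le_box (X : set E) (c : E * E) :
  X `<=` box c -> (outer X <= (box_volume c)%:E)%E.
Proof.
move=> Xc; pose c' k := if k is 0%N then c else (0, 0) : E * E.
apply: (@le_trans _ _ (\sum_(0 <= k <oo) (box_volume (c' k))%:E)%E).
  by apply: ereal_inf_lbound; exists c' => // x /Xc; exists 0%N.
rewrite (nneseriesD1 (n := 0%N))//=; last first.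
  by move=> k _; rewrite lee_fin box_volume_ge0.
rewrite eseries0 ?adde0// => -[|k] _ //= _.
by rewrite /box_volume big_ord_recl !mxE subrr maxxx mul0r.
Qed.

Lemma leb_ball_lty (p : E) (e : R) : (leb R N (ball p e) < +oo)%E.
Proof.
apply: le_lt_trans (ltry _).
apply: (@lebesgue_outer_le_box _ (p - const_mx e, p + const_mx e)).
move=> x [_ px] i; have := px ord0 i.
by rewrite /= !mxE /ball/= ltr_norml => /andP[? ?]; lra.
Qed.

Lemma leb_sigma_finite : sigma_finite setT (leb R N).
Proof.
exists (fun n => ball (0 : E) n.+1%:R); last first.
  by move=> n; split; [exact: measurable_ball_row|exact: leb_ball_lty].
apply/seteqP; split => // x _; exists (Num.truncn `|x|) => //.
by rewrite -ball_normE /= sub0r normrN truncnS_gt.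
Qed.

Lemma lebesgue_outer_shift (X : set E) (t : E) :
  (outer [set x | X (x - t)%R] <= outer X)%E.
Proof.
apply: le_ereal_inf_tmp => _ [c Xc <-].
have -> : (\sum_(0 <= k <oo) (box_volume (c k))%:E =
    \sum_(0 <= k <oo) (box_volume ((c k).1 + t, (c k).2 + t)%R)%:E)%E.
  apply: eq_eseriesr => k _; congr EFin.
  by apply: eq_bigr => i _; rewrite !mxE; congr Num.max; ring.
apply: ereal_inf_lbound; exists (fun k => ((c k).1 + t, (c k).2 + t)) => //.
move=> x /Xc[k _ xk]; exists k => // i; have := xk i.
by rewrite /= !mxE ltrBrDr lerBlDr.
Qed.

Lemma ball_rat (x : E) (e : R) : 0 < e ->
  exists q : 'rV[rat]_N.+1, ball (map_mx ratr q : E) e x.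
Proof.
move=> e0.
have /choice[q qP] : forall i, exists q : rat, `|ratr q - x ord0 i| < e.
  move=> i; have [|q] := @rat_in_itvoo R (x ord0 i - e) (x ord0 i + e).
    by lra.
  by rewrite in_itv/= => /andP[? ?]; exists q; rewrite ltr_norml; lra.
exists (\row_i q i); split => // i j.
by rewrite (ord1 i) !mxE; exact: qP.
Qed.

(** If a ball were null, so would all its translates, and countably many of them
    cover the space. *)
Lemma leb_open_gt0 (U : set E) : open U -> U !=set0 ->
  (0 < leb R N setT)%E -> (0 < leb R N U)%E.
Proof.
move=> oU [p Up]; apply: contraTT; rewrite -!leNgt => U0.
have /nbhs_ballP[e /= e0 peU] : nbhs p U by exact: open_nbhs_nbhs.
have ball0 q : (outer (ball q e) <= 0)%E.
  apply: le_trans (le_trans (le_lebesgue_outer peU) U0).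
  apply: le_trans (lebesgue_outer_shift _ (q - p)); apply: le_lebesgue_outer.
  move=> x [_ qx]; split => // i j; have := qx i j.
  by rewrite /ball/= !mxE; congr (`|_| < _); ring.
pose F n : set E := if unpickle n is Some q
  then ball (map_mx ratr (q : 'rV[rat]_N.+1) : E) e else set0.
have <- : \bigcup_n F n = setT.
  apply/seteqP; split => // x _; have [q qx] := ball_rat x e0.
  by exists (pickle q) => //; rewrite /F pickleK.
apply: le_trans (lebesgue_outer_sigma_subadditive F) _.
rewrite eseries0// => n _ _; apply/eqP.
rewrite eq_le lebesgue_outer_ge0 andbT /F.
by case: unpickle => [q|]; rewrite ?lebesgue_outer0.
Qed.

(** An open set of pairs is a countable union of products of balls with rational
    centers and radii 1 / (n + 1). *)
Lemma open_measurable_prod (U : set (E * E)) : open U ->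
  measurable (U : set (lebT R N * lebT R N)).
Proof.
move=> oU; pose r (n : nat) : R := n.+1%:R^-1.
pose B (q : 'rV[rat]_N.+1) n : set E := ball (map_mx ratr q : E) (r n).
pose F (i : 'rV[rat]_N.+1 * 'rV[rat]_N.+1 * nat) : set (E * E) :=
  B i.1.1 i.2 `*` B i.1.2 i.2.
have -> : U = \bigcup_i (if `[< F i `<=` U >] then F i else set0).
  apply/seteqP; split => [x Ux|x [i _]]; last first.
    by case: asboolP => [FU|_ []]; exact: FU.
  have /nbhs_ballP[e /= e0 xeU] : nbhs x U by exact: open_nbhs_nbhs.
  have [n rn] : exists n, r n < e / 2.
    have [n _ /(_ n)/=] := near_infty_natSinv_lt (PosNum (divr_gt0 e0 (ltr0Sn _ 1))).
    by move=> /(_ (leqnn _)); exists n.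
  have r0 : 0 < r n by rewrite invr_gt0.
  have [q1 q1x] := ball_rat x.1 r0; have [q2 q2x] := ball_rat x.2 r0.
  exists (q1, q2, n) => //; case: asboolP => [//|[]] z [z1 z2]; apply: xeU.
  have re : r n + r n <= e by lra.
  by split; apply: (le_ball re); [apply: ball_triangle z1|apply: ball_triangle z2];
    exact: ball_sym.
apply: countable_bigcupT_measurable; first exact: countableP.
move=> i; case: asboolP => // _.
by apply: measurableX; exact: measurable_ball_row.
Qed.

Lemma continuous_measurable_prod (V : E * E -> R) : continuous V ->
  measurable_fun (setT : set (lebT R N * lebT R N)) V.
Proof.
move=> /continuousP cV; apply: (measurability _ (RGenOpens.measurableE R)).
move=> _ [_ [a [b ->] <-]]; rewrite setTI; apply: open_measurable_prod.
exact/cV/interval_open.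
Qed.

(** [U] is a section of the open set [U x R^N]. *)
Lemma open_measurable_row (U : set E) : open U ->
  measurable (U : set (lebT R N)).
Proof.
move=> oU.
have mU : measurable (fst @^-1` U : set (lebT R N * lebT R N)).
  by apply: open_measurable_prod; apply: open_comp => // x _; exact: cvg_fst.
have := @pair2_measurable _ _ (lebT R N) (lebT R N) (0 : E) measurableT _ mU.
by rewrite setTI.
Qed.

End lebesgue_topology.

HB.instance Definition _ (R : realType) (N : nat) :=
  Measure_isSigmaFinite.Build _ _ _ (leb R N) (@leb_sigma_finite R N).

(** * The Poincare inequality on a bounded set of R^N *)

Section poincare_row.
Context (R : realType) (N : nat).
Notation E := 'rV[R]_N.+1.
Notation mu := (leb R N).

(** Connectedness of the space, read along the segment from a point of [P]. *)
Lemma row_clopen (P : set E) : open P -> open (~` P) -> P !=set0 -> P = setT.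
Proof.
move=> oP oP' [p Pp]; apply/seteqP; split => // x _.
pose phi (t : R) : E := p + t *: (x - p).
have cphi : continuous phi.
  by move=> t; apply: cvgD; [exact: cvg_cst|apply: cvgZl; exact: cvg_id].
suff [_] : (`[0, 1]%classic `&` phi @^-1` P) (1 : R).
  by rewrite /phi /= scale1r addrC subrK.
suff -> : `[0, 1]%classic `&` phi @^-1` P = `[0, 1]%classic.
  by rewrite /= in_itv/= ler01 lexx.
apply: (@segment_connected R 0 1).
- exists 0; split; first by rewrite /= in_itv/= ler01 lexx.
  by rewrite /phi /= scale0r addr0.
- by exists (phi @^-1` P) => //; apply: open_comp => // t _; exact: cphi.
exists (phi @^-1` P) => //; apply: closed_comp => [t _|]; first exact: cphi.
by rewrite -[P]setCK; exact: open_closedC.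
Qed.

Variables (k : E -> E -> R) (M : R).
Hypothesis mk : measurable_fun (setT : set (lebT R N * lebT R N))
  (fun z : E * E => k z.1 z.2).
Hypothesis M0 : 0 < M.
Hypothesis k0 : forall x y, 0 <= k x y.
Hypothesis ksym : forall x y, k x y = k y x.
Hypothesis kM : forall x, (\int[mu]_y (k x y)%:E <= M%:E)%E.
Hypothesis mu0 : (0 < mu setT)%E.
Hypothesis klocal : forall z : E, exists e c : R, [/\ 0 < e, 0 < c &
  forall x y, ball z e x -> ball z e y -> c <= k x y].
Variable Omega : set E.
Hypothesis Omega_bounded : bounded_set Omega.

(** The points with a controlled ball form an open set.  It is closed: if such
    points come close to [y], part of the ball of one of them lies where the
    kernel is bounded below, and control passes from there to a ball around
    [y].  It is nonempty: a ball that misses Omega is controlled. *)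
Lemma controlled_ball (x : E) :
  exists2 e : R, 0 < e & controlled mu k Omega (ball x e).
Proof.
pose P := [set x : E | exists2 e : R, 0 < e & controlled mu k Omega (ball x e)].
suff : P = setT by move=> PT; have : P x by rewrite PT.
have sub (U V : set E) : open U -> open V -> U `<=` V ->
    controlled mu k Omega V -> controlled mu k Omega U.
  move=> oU oV.
  exact: controlled_subset (open_measurable_row oU) (open_measurable_row oV).
have bo (y : E) (e : R) : open (ball y e) by exact: ball_open.
apply: row_clopen.
- rewrite openE => y [e e0 ye]; apply/nbhs_ballP; exists (e / 2).
    by rewrite /= divr_gt0.
  move=> z yz; exists (e / 2); first by rewrite divr_gt0.
  apply: sub ye => // w zw; rewrite (splitr e); exact: ball_triangle zw.
- rewrite openE => y nPy; have [e [c [e0 c0 ck]]] := klocal y.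
  apply/nbhs_ballP; exists e; first exact: e0.
  move=> z yz [r r0 zr]; apply: nPy; exists e; first exact: e0.
  have oQ : open (ball z r `&` ball y e) by exact: openI.
  have Q0 : (0 < mu (ball z r `&` ball y e))%E.
    apply: leb_open_gt0 => //; exists z; split=> //; exact: ballxx.
  apply: (controlled_transfer mk M0 k0 ksym kM _ _ _ _ Q0 c0).
  - exact: measurable_ball_row.
  - exact: open_measurable_row.
  - exact: leb_ball_lty.
  - apply: le_lt_trans (leb_ball_lty y e).
    by apply: le_measure; rewrite ?inE; 
      [exact: open_measurable_row|exact: measurable_ball_row|exact: subIsetr].
  - by move=> u v yu [_ yv]; exact: ck.
  - apply: sub zr => //; exact: subIsetl.
have [m [_ mP]] := Omega_bounded.
(* The first coordinate is above |m| + 2 on this ball and below it on Omega. *)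
exists (const_mx (`|m| + 3)), 1 => //; apply: controlled_off.
  exact: measurable_ball_row.
apply/seteqP; split => // y [[_ by_] Oy].
have m1 : m < `|m| + 1 by rewrite (le_lt_trans (ler_norm m))// ltrDl.
have ym := mP _ m1 y Oy.
have : ball (0 : E) (`|m| + 2) y.
  rewrite -ball_normE /= sub0r normrN (le_lt_trans ym)//; lra.
move=> [_ /(_ ord0 ord0)]; have := by_ ord0 ord0.
by rewrite /ball/= !mxE !ltr_norml => /andP[? ?] /andP[? ?]; lra.
Qed.

(** Finitely many controlled balls cover a closed ball containing Omega, and [v]
    vanishes outside of it. *)
Lemma poincare : exists C : R, forall v, v \in Lfun mu 2%:E ->
  vanishing mu Omega v -> (\int[mu]_x (v x ^+ 2) <= C * dform mu k v v)%R.
Proof.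
have [m [_ mP]] := Omega_bounded.
have m1 : m < `|m| + 1 by rewrite (le_lt_trans (ler_norm m))// ltrDl.
have a0 : 0 < `|m| + 1 by have := normr_ge0 m; lra.
pose K := closed_ball (0 : E) (`|m| + 1).
have mball (x : E) (e : R) : measurable (ball x e : set (lebT R N)).
  exact: measurable_ball_row.
have cK : compact K.
  apply: bounded_closed_compact; last exact: closed_ball_closed.
  exists (`|m| + 1); split; first exact: num_real.
  move=> a am x; rewrite /K closed_ballE//.
  by rewrite /closed_ball_/= sub0r normrN => /le_trans; apply; exact: ltW.
have [e e0 ce] : exists2 e : E -> R, forall x, 0 < e x &
    forall x, controlled mu k Omega (ball x (e x)).
  have /choice[e eP] : forall x : E, exists e : R,
      0 < e /\ controlled mu k Omega (ball x e).
    by move=> x; have [e ? ?] := controlled_ball x; exists e.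
  by exists e => x; have [] := eP x.
move: cK; rewrite compact_cover => /(_ E setT (fun x => ball x (e x)))[].
- by move=> x _; exact: ball_open.
- by move=> x _; exists x => //; exact: ballxx.
move=> D _ KD; pose F (s : seq E) := \bigcup_(x in [set` s]) ball x (e x).
have mF s : measurable (F s : set (lebT R N)).
  apply: fin_bigcup_measurable; first exact: finite_seq.
  by move=> x _; exact: mball.
have cF s : controlled mu k Omega (F s).
  elim: s => [|x s IH].
    apply: controlled_off; first exact: mF.
    by rewrite /F set_nil bigcup_set0 set0I.
  rewrite (_ : F (x :: s) = ball x (e x) `|` F s).
    by apply: controlled_setU => //; exact: mball.
  by rewrite /F !bigcup_seq big_cons.
have KF : K `<=` F (finmap.enum_fset D) by move=> x /KD[i Di xi]; exists i.
have [C CP] : controlled mu k Omega setT.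
  rewrite -(setUv (F (finmap.enum_fset D))); apply: controlled_setU => //.
    exact: measurableC.
  apply: controlled_off; first exact: measurableC.
  apply/seteqP; split => // x [nDx Ox]; apply: nDx; apply: KF.
  rewrite /K closed_ballE//.
  by rewrite /closed_ball_/= sub0r normrN; exact: mP Ox.
exists C => v v2 v0; rewrite -lee_fin; apply: le_trans (CP v v2 v0).
have /Lfun2P[_ iv] := v2.
by rewrite /Rintegral fineK//; exact: integrable_fin_num.
Qed.

End poincare_row.

(** * The kernel of the two-phase problem *)

Lemma quarter_half (R : realType) (a b c : \bar R) :
  (0 <= a -> 0 <= b -> 0 <= c ->
   (4^-1)%:E * ((a + b) + (b + c)) =
   (4^-1)%:E * a + (4^-1)%:E * c + (2^-1)%:E * b)%E.
Proof.
move=> a0 b0 c0.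
have -> : (2^-1)%:E = ((4^-1)%:E + (4^-1)%:E)%E :> \bar R.
  by rewrite -EFinD; congr EFin; lra.
rewrite ge0_muleDl ?lee_fin// ge0_muleDr; [|exact: adde_ge0..].
by rewrite !ge0_muleDr// [X in (_ + X)%E = _]addeC addeACA.
Qed.

Definition two_phase (T : Type) (R : realType) (J G K : T -> T -> R)
    (A : set T) (x y : T) : R :=
  if x \in A then if y \in A then J x y else K x y
  else if y \in A then K x y else G x y.

Lemma two_phase_ind (T : Type) (R : realType) (J G K : T -> T -> R)
    (A : set T) (P : R -> Prop) x y :
  P (J x y) -> P (G x y) -> P (K x y) -> P (two_phase J G K A x y).
Proof. by rewrite /two_phase; case: ifP => _; case: ifP. Qed.

Lemma two_phase_ge0 (T : Type) (R : realType) (J G K : T -> T -> R)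
    (A : set T) : (forall x y, 0 <= J x y) -> (forall x y, 0 <= G x y) ->
  (forall x y, 0 <= K x y) -> forall x y, 0 <= two_phase J G K A x y.
Proof.
by move=> J0 G0 K0 x y; exact: (@two_phase_ind _ _ _ _ _ _ (fun r => 0 <= r)).
Qed.

Lemma two_phase_sym (T : Type) (R : realType) (J G K : T -> T -> R)
    (A : set T) : (forall x y, J x y = J y x) -> (forall x y, G x y = G y x) ->
  (forall x y, K x y = K y x) ->
  forall x y, two_phase J G K A x y = two_phase J G K A y x.
Proof.
move=> Jsym Gsym Ksym x y; rewrite /two_phase Jsym Gsym Ksym.
by case: (x \in A); case: (y \in A).
Qed.

Section two_phase_kernel.
Context d (T : measurableType d) (R : realType).
Variable mu : {sigma_finite_measure set T -> \bar R}.
Variables (J G K : T -> T -> R) (A : set T).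
Hypothesis mA : measurable A.
Hypothesis mJ : measurable_fun setT (fun z : T * T => J z.1 z.2).
Hypothesis mG : measurable_fun setT (fun z : T * T => G z.1 z.2).
Hypothesis mK : measurable_fun setT (fun z : T * T => K z.1 z.2).
Hypothesis J0 : forall x y, 0 <= J x y.
Hypothesis G0 : forall x y, 0 <= G x y.
Hypothesis K0 : forall x y, 0 <= K x y.
Hypothesis Ksym : forall x y, K x y = K y x.
Hypothesis J1 : forall x, (\int[mu]_y (J x y)%:E = 1)%E.
Hypothesis G1 : forall x, (\int[mu]_y (G x y)%:E = 1)%E.
Hypothesis K1 : forall x, (\int[mu]_y (K x y)%:E = 1)%E.

Notation k := (two_phase J G K A).

Let two_phase_ge0 := two_phase_ge0 A J0 G0 K0.

Lemma measurable_two_phase :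
  measurable_fun setT (fun z : T * T => k z.1 z.2).
Proof.
have mB : measurable (~` A) by exact: measurableC.
rewrite (_ : (fun z => _) = (fun z : T * T =>
    \1_A z.1 * (\1_A z.2 * J z.1 z.2 + \1_(~` A) z.2 * K z.1 z.2)
    + \1_(~` A) z.1 * (\1_A z.2 * K z.1 z.2 + \1_(~` A) z.2 * G z.1 z.2))); last first.
  apply/funext => z; rewrite /two_phase !indicE !in_setC.
  by case: (z.1 \in A); case: (z.2 \in A);
    rewrite /= ?mul1r ?mul0r ?addr0 ?add0r.
have m1 (D : set T) : measurable D ->
    measurable_fun setT (fun z : T * T => \1_D z.1 : R).
  by move=> mD; exact: measurableT_comp.
have m2 (D : set T) : measurable D ->
    measurable_fun setT (fun z : T * T => \1_D z.2 : R).
  by move=> mD; exact: measurableT_comp.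
by apply: measurable_funD; (apply: measurable_funM; first exact: m1);
  apply: measurable_funD; (apply: measurable_funM; first exact: m2).
Qed.

Lemma two_phase_mass x : (\int[mu]_y (k x y)%:E <= 3%:E)%E.
Proof.
have mx V (mV : measurable_fun setT (fun z : T * T => V z.1 z.2)) :
    measurable_fun setT (fun y => (V x y)%:E : \bar R).
  by apply/measurable_EFinP; exact: (measurableT_comp mV (pair1_measurable x)).
apply: (@le_trans _ _
    (\int[mu]_y ((J x y)%:E + (G x y)%:E + (K x y)%:E))%E).
  apply: ge0_le_integral => //.
  - by move=> y _; rewrite lee_fin two_phase_ge0.
  - exact: (mx k measurable_two_phase).
  - apply: emeasurable_funD; last exact: mx.
    by apply: emeasurable_funD; exact: mx.
  move=> y _; rewrite -!EFinD lee_fin.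
  apply: (@two_phase_ind _ _ _ _ _ _ (fun r => r <= J x y + G x y + K x y));
    have := J0 x y; have := G0 x y; have := K0 x y; lra.
rewrite ge0_integralD//; [|by move=> y _; rewrite -EFinD lee_fin addr_ge0
  |by apply: emeasurable_funD; exact: mx|by move=> y _; rewrite lee_fin
  |exact: mx].
rewrite ge0_integralD//; [|by move=> y _; rewrite lee_fin|exact: mx
  |by move=> y _; rewrite lee_fin|exact: mx].
by rewrite J1 G1 K1 -!EFinD lee_fin; lra.
Qed.

(** Of the four terms on the right, the two carrying the phase of [x] add up to
    the whole integral, and the indicators kill the other two. *)
Lemma integral_two_phase x (g : T -> R) :
  measurable_fun setT g ->
  (\int[mu]_y (k x y * g y)%:E =
   (\1_A x)%:E * \int[mu]_(y in A) (J x y * g y)%:E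
   + (\1_A x)%:E * \int[mu]_(y in ~` A) (K x y * g y)%:E
   + (\1_(~` A) x)%:E * \int[mu]_(y in A) (K x y * g y)%:E
   + (\1_(~` A) x)%:E * \int[mu]_(y in ~` A) (G x y * g y)%:E)%E.
Proof.
move=> mg; have mB : measurable (~` A) by exact: measurableC.
have mt : measurable_fun setT (fun y => (k x y * g y)%:E).
  apply/measurable_EFinP; apply: measurable_funM => //.
  exact: (measurableT_comp measurable_two_phase (pair1_measurable x)).
rewrite -{1}(setUv A) integral_setU//; last 2 first.
- by rewrite setUv.
- by apply/disj_setPS; rewrite setICr.
rewrite !indicE in_setC; have [Ax|Ax] := boolP (x \in A).
  rewrite /= !mul0e !mul1e !adde0; congr (_ + _)%E; apply: eq_integral => y yA.
    by rewrite /two_phase Ax yA.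
  by move: yA; rewrite in_setC /two_phase Ax => /negbTE ->.
rewrite /= !mul0e !mul1e !add0e; congr (_ + _)%E; apply: eq_integral => y yA.
  by rewrite /two_phase (negbTE Ax) yA.
by move: yA; rewrite in_setC /two_phase (negbTE Ax) => /negbTE ->.
Qed.

(** The factor 1/2 of the mixed term collects the two mixed rectangles, which
    contribute equally by Tonelli's theorem and the symmetry of [K]. *)
Lemma two_phase_energy (v : T -> R) : measurable_fun setT v ->
  ((4^-1)%:E * \int[mu]_x \int[mu]_y (k x y * (v y - v x) ^+ 2)%:E =
   (4^-1)%:E * \int[mu]_(x in A) \int[mu]_(y in A) (J x y * (v y - v x) ^+ 2)%:E
   + (4^-1)%:E *
     \int[mu]_(x in ~` A) \int[mu]_(y in ~` A) (G x y * (v y - v x) ^+ 2)%:E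
   + (2^-1)%:E *
     \int[mu]_(x in A) \int[mu]_(y in ~` A) (K x y * (v y - v x) ^+ 2)%:E)%E.
Proof.
move=> mv; have mB : measurable (~` A) by exact: measurableC.
have mF (V : T -> T -> R) : measurable_fun setT (fun z : T * T => V z.1 z.2) ->
    measurable_fun setT (fun z : T * T => V z.1 z.2 * (v z.2 - v z.1) ^+ 2).
  move=> mV; apply: measurable_funM => //; apply: measurable_funX.
  by apply: measurable_funB; exact: measurableT_comp.
have F0 (V : T -> T -> R) : (forall x y, 0 <= V x y) ->
    forall x y, (0 <= (V x y * (v y - v x) ^+ 2)%:E)%E.
  by move=> V0 x y; rewrite lee_fin mulr_ge0// sqr_ge0.
have mI (V : T -> T -> R) (D : set T) : measurable D -> (forall x y, 0 <= V x y) ->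
    measurable_fun setT (fun z : T * T => V z.1 z.2) ->
    measurable_fun setT (fun x => \int[mu]_(y in D) (V x y * (v y - v x) ^+ 2)%:E)%E.
  move=> mD V0 mV; under eq_fun do rewrite integral_mkcond.
  apply: (measurable_fun_fubini_tonelli_F
    (fun z => (((fun y => (V z.1 y * (v y - v z.1) ^+ 2)%:E) \_ D) z.2))) => /=;
    last first.
    by move=> z; rewrite patchE; case: ifP => // _; exact: F0.
  rewrite (_ : (fun z => _) = (fun z : T * T =>
      (\1_D z.2 * (V z.1 z.2 * (v z.2 - v z.1) ^+ 2))%:E)); last first.
    apply/funext => z; rewrite patchE indicE.
    by case: ifP; rewrite ?mul1r ?mul0r.
  apply/measurable_EFinP; apply: measurable_funM; last exact: mF.
  exact: measurableT_comp.
have I0 (V : T -> T -> R) (D : set T) : (forall x y, 0 <= V x y) -> forall x,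
    (0 <= \int[mu]_(y in D) (V x y * (v y - v x) ^+ 2)%:E)%E.
  by move=> V0 x; apply: integral_ge0 => y _; exact: F0.
pose I (V : T -> T -> R) (D : set T) x :=
  (\int[mu]_(y in D) (V x y * (v y - v x) ^+ 2)%:E)%E.
have disj : [disjoint A & ~` A] by apply/disj_setPS; rewrite setICr.
have IT x : I k setT x = (I k A x + I k (~` A) x)%E.
  rewrite {1}/I -{1}(setUv A) ge0_integral_setU//.
    rewrite setUv; apply/measurable_EFinP.
    exact: (measurableT_comp (mF _ measurable_two_phase) (pair1_measurable x)).
  by move=> y _; exact: (F0 _ two_phase_ge0 x y).
have IA x : A x -> I k setT x = (I J A x + I K (~` A) x)%E.
  move=> /mem_set xA; rewrite IT.
  congr (_ + _)%E; apply: eq_integral => y yA.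
    by rewrite /two_phase xA yA.
  by move: yA; rewrite in_setC /two_phase xA => /negbTE ->.
have IB x : ~ A x -> I k setT x = (I K A x + I G (~` A) x)%E.
  move=> nAx; have xA := memNset nAx; rewrite IT.
  congr (_ + _)%E; apply: eq_integral => y yA.
    by rewrite /two_phase xA yA.
  by move: yA; rewrite in_setC /two_phase xA => /negbTE ->.
have KAB : (\int[mu]_(x in ~` A) I K A x = \int[mu]_(x in A) I K (~` A) x)%E.
  have F0' z : 0 <= K z.1 z.2 * (v z.2 - v z.1) ^+ 2.
    by rewrite mulr_ge0// sqr_ge0.
  rewrite [LHS](tonelli_rectangle mu mB mA (mF _ mK) F0').
  apply: eq_integral => x _; apply: eq_integral => y _ /=.
  by rewrite Ksym -(opprB (v x)) sqrrN.
have split2 (f g h : T -> \bar R) (D : set T) : measurable D ->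
    measurable_fun setT f -> measurable_fun setT g ->
    (forall x, 0 <= f x)%E -> (forall x, 0 <= g x)%E ->
    (forall x, D x -> h x = f x + g x)%E ->
    (\int[mu]_(x in D) h x =
     \int[mu]_(x in D) f x + \int[mu]_(x in D) g x)%E.
  move=> mD mf mg f0 g0 hfg.
  rewrite -ge0_integralD//; [|exact: measurable_funTS..].
  by apply: eq_integral => x; rewrite inE; exact: hfg.
have SA := split2 _ _ _ _ mA (mI _ _ mA J0 mJ) (mI _ _ mB K0 mK)
  (I0 _ _ J0) (I0 _ _ K0) IA.
have SB := split2 _ _ _ _ mB (mI _ _ mA K0 mK) (mI _ _ mB G0 mG)
  (I0 _ _ K0) (I0 _ _ G0) IB.
have outer (f : T -> \bar R) : measurable_fun setT f -> (forall x, 0 <= f x)%E ->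
    (\int[mu]_x f x = \int[mu]_(x in A) f x + \int[mu]_(x in ~` A) f x)%E.
  by move=> mf f0; rewrite -{1}(setUv A) ge0_integral_setU// setUv.
have := outer _ (mI _ _ measurableT two_phase_ge0 measurable_two_phase)
  (I0 _ _ two_phase_ge0).
rewrite -/(I k setT) SA SB KAB => ->.
have int0 (V : T -> T -> R) (D D' : set T) : (forall x y, 0 <= V x y) ->
    (0 <= \int[mu]_(x in D) I V D' x)%E.
  by move=> V0; apply: integral_ge0 => x _; exact: I0.
by apply: quarter_half; exact: int0.
Qed.

End two_phase_kernel.

(** * Continuous kernels and the theorem *)

Section nonlocal_kernel_facts.
Context (R : realType) (N : nat).
Notation E := 'rV[R]_N.+1.
Notation mu := (leb R N).

Lemma kernel_local_lower_bound (V : E -> E -> R) (z : E) : nonlocal_kernel V ->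
  exists e c : R, [/\ 0 < e, 0 < c &
    forall x y, ball z e x -> ball z e y -> c <= V x y].
Proof.
move=> [cV _ Vp _ _]; have z0 := Vp z.
have : \forall p \near (z, z), V z z / 2 < V p.1 p.2.
  have := cV (z, z) => /cvgr_gt; apply; rewrite /=; lra.
move=> /nbhs_ballP[e /= e0 eP]; exists e, (V z z / 2); split=> //.
  by rewrite divr_gt0.
by move=> x y zx zy; apply: ltW; exact: (eP (x, y)).
Qed.

Lemma nonlocal_kernel_measurable (V : E -> E -> R) : nonlocal_kernel V ->
  measurable_fun (setT : set (lebT R N * lebT R N)) (fun p => V p.1 p.2).
Proof. by move=> [cV _ _ _ _]; exact: continuous_measurable_prod. Qed.

(** Kernels integrate to 1, which is impossible for the zero measure. *)
Lemma leb_setT_gt0 (V : E -> E -> R) : nonlocal_kernel V ->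
  (0 < mu setT)%E.
Proof.
move=> kV; have [_ _ _ _ V1] := kV.
rewrite lt_neqAle lebesgue_outer_ge0 andbT; apply/eqP => /esym mu0.
have mV : measurable_fun (setT : set (lebT R N)) (EFin \o V 0).
  apply/measurable_EFinP.
  exact: (@measurable_kernel_section _ (lebT R N) R V (nonlocal_kernel_measurable kV) 0).
have := null_set_integral measurableT mV mu0.
by rewrite /= V1 => /eqP; rewrite onee_eq0.
Qed.

End nonlocal_kernel_facts.

Theorem theorem5p1 (R : realType) (N : nat) (Omega : set 'rV[R]_N.+1)
  (J G K : 'rV[R]_N.+1 -> 'rV[R]_N.+1 -> R) (A B : nat -> set 'rV[R]_N.+1)
  (Omega_open : open Omega) (Omega_connected : connected Omega)
  (Omega_bounded : bounded_set Omega)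
  (kerJ : nonlocal_kernel J) (kerG : nonlocal_kernel G)
  (kerK : nonlocal_kernel K)
  (mA : forall n, (1 <= n)%N -> measurable (A n : set (lebT R N)))
  (mB : forall n, (1 <= n)%N -> measurable (B n : set (lebT R N)))
  (ABT : forall n, (1 <= n)%N -> A n `|` B n = setT)
  (AB0 : forall n, (1 <= n)%N -> A n `&` B n = set0)
  (n : nat) (n1 : (1 <= n)%N) (f : 'rV[R]_N.+1 -> R) (Wf : W_Dir Omega f) :
  exists u : 'rV[R]_N.+1 -> R,
    [/\ W_Dir Omega u,
        solves Omega J G K (A n) (B n) f u,
        (forall w, W_Dir Omega w -> solves Omega J G K (A n) (B n) f w ->
           w = u %[ae leb R N]),
        minimizer (W_Dir Omega) (energy Omega J G K (A n) (B n) f) u &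
        (forall w,
           minimizer (W_Dir Omega) (energy Omega J G K (A n) (B n) f) w ->
           w = u %[ae leb R N])].
Proof.
have -> : B n = ~` A n.
  by apply/seteqP; split=> x; [move=> Bx Ax; rewrite -[False]/(set0 x) -(AB0 n n1)
    |move=> nAx; have [] : (A n `|` B n) x by rewrite ABT].
have {}mA := mA n n1; move: (A n) mA => {AB0 ABT mB B}A mA.
have [mJ mG mK] : [/\ measurable_fun setT (fun p : lebT R N * lebT R N => J p.1 p.2),
   measurable_fun setT (fun p : lebT R N * lebT R N => G p.1 p.2) &
   measurable_fun setT (fun p : lebT R N * lebT R N => K p.1 p.2)].
  by split; exact: nonlocal_kernel_measurable.
have [_ J0 _ Jsym J1] := kerJ; have [_ G0 _ Gsym G1] := kerG.
have [_ K0 _ Ksym K1] := kerK.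
pose mu := leb R N.
pose k := two_phase J G K A.
have mk : measurable_fun setT (fun p : lebT R N * lebT R N => k p.1 p.2).
  exact: (@measurable_two_phase _ (lebT R N) R J G K A mA mJ mG mK).
have k0 x y : 0 <= k x y by exact: (two_phase_ge0 A J0 G0 K0).
have ksym x y : k x y = k y x by exact: (two_phase_sym A Jsym Gsym Ksym).
have kM x : (\int[mu]_y (k x y)%:E <= 3%:E)%E.
  exact: (@two_phase_mass _ (lebT R N) R mu J G K A mA mJ mG mK J0 G0 K0 J1 G1 K1).
have M0 : 0 < 3 :> R by [].
have klocal (z : 'rV[R]_N.+1) : exists e c : R, [/\ 0 < e, 0 < c &
    forall x y, ball z e x -> ball z e y -> c <= k x y].
  have [e1 [c1 [e10 c10 h1]]] := kernel_local_lower_bound z kerJ.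
  have [e2 [c2 [e20 c20 h2]]] := kernel_local_lower_bound z kerG.
  have [e3 [c3 [e30 c30 h3]]] := kernel_local_lower_bound z kerK.
  exists (Num.min e1 (Num.min e2 e3)), (Num.min c1 (Num.min c2 c3)).
  split; [by rewrite !lt_min e10 e20|by rewrite !lt_min c10 c20|].
  move=> x y zx zy.
  have b1 w : ball z (Num.min e1 (Num.min e2 e3)) w -> ball z e1 w.
    by apply: le_ball; rewrite !ge_min lexx.
  have b2 w : ball z (Num.min e1 (Num.min e2 e3)) w -> ball z e2 w.
    by apply: le_ball; rewrite !ge_min lexx orbT.
  have b3 w : ball z (Num.min e1 (Num.min e2 e3)) w -> ball z e3 w.
    by apply: le_ball; rewrite !ge_min lexx !orbT.
  apply: (@two_phase_ind _ _ _ _ _ _ (fun r => Num.min c1 (Num.min c2 c3) <= r)).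
  - by rewrite ge_min h1//; exact: b1.
  - by rewrite !ge_min h2 ?orbT//; exact: b2.
  - by rewrite !ge_min h3 ?orbT//; exact: b3.
have coer := poincare mk M0 k0 ksym kM (leb_setT_gt0 kerJ) klocal Omega_bounded.
have mOmega : measurable (Omega : set (lebT R N)) by exact: open_measurable_row.
have fOmega : (mu Omega < +oo)%E.
  have [m [_ mP]] := Omega_bounded.
  have m1 : m < `|m| + 1 by rewrite (le_lt_trans (ler_norm m))// ltrDl.
  apply: le_lt_trans (leb_ball_lty 0 (`|m| + 2)); apply: le_lebesgue_outer.
  move=> x /(mP _ m1) xm; rewrite -ball_normE /= sub0r normrN.
  by rewrite (le_lt_trans xm)//; lra.
have solvesE u : W_Dir Omega u ->
    solves Omega J G K A (~` A) f u <-> solution mu k Omega f u.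
  move=> [u2 _].
  have opE : nonlocal_op J G K A (~` A) u =
      fun x => (\int[mu]_y (k x y * (u y - u x))%:E)%E.
    apply/funext => x; apply/esym.
    have mux : measurable_fun (setT : set (lebT R N)) (fun y => u y - u x).
      by apply: measurable_funB => //; exact: Lfun2_measurable u2.
    exact: (@integral_two_phase _ (lebT R N) R mu J G K A mA mJ mG mK x _ mux).
  by rewrite /solves opE.
have [f2 f0] := Wf.
have energyE v : W_Dir Omega v ->
    energy Omega J G K A (~` A) f v = (potential mu k f v)%:E.
  move=> [v2 v0]; rewrite /potential EFinD.
  rewrite -(integral_vanishing mOmega f2 v2 v0) mulrC EFinM.
  rewrite (dform_tonelli mk M0 k0 ksym kM v2) two_phase_energy//.
  exact: Lfun2_measurable v2.
have [u [u2 u0 fu]] := solution_exists mk M0 k0 ksym kM coer mOmega fOmega f2.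
have Wu : W_Dir Omega u by [].
exists u; split=> //.
- exact/solvesE.
- move=> w Ww /(solvesE _ Ww) fw; have [w2 w0] := Ww.
  apply: (minimizer_eq_solution mk M0 k0 ksym kM coer f2 u2 u0 fu w2 w0).
  exact: (solution_minimizes mk M0 k0 ksym kM f2 w2 w0 fw u2 u0).
- split=> // v Wv; have [v2 v0] := Wv; rewrite !energyE// lee_fin.
  exact: (solution_minimizes mk M0 k0 ksym kM f2 u2 u0 fu v2 v0).
- move=> w [Ww wmin]; have [w2 w0] := Ww.
  apply: (minimizer_eq_solution mk M0 k0 ksym kM coer f2 u2 u0 fu w2 w0).
  by have := wmin u Wu; rewrite !energyE// lee_fin.
Qed.
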